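(* Let $r \geq 3$ and $2 \leq q \leq \binom{r}{2}$, and write $\binom{r}{2} = aq + b$ with integers $a \geq 0$ and $0 \leq b < q$. If $r + b \geq q$ or $b = 0$, then $\delta_{r,q} = \frac{r}{r+1}$.
   Context: A $q$-edge-colored graph is a pair $(G,f)$ with $f: E(G) \to [q]$. For a $q$-edge-colored graph $(F,f)$, its discrepancy is the largest $t$ such that some color $c \in [q]$ appears on at least $\frac{e(F)+t}{q}$ edges of $F$. A $K_r$-tiling of a graph $G$ is a collection of vertex-disjoint copies of $K_r$ in $G$ whose vertex sets partition $V(G)$; its discrepancy is that of the edge-colored graph formed by the union of its copies. For $r \geq 3$, $q \geq 2$, $\delta_{r,q}$ is the infimum of those $\delta > 0$ for which there exists $\zeta > 0$ such that for all sufficiently large $n$, for every $n$-vertex graph $G$ with $r \mid n$ and minimum degree $\delta(G) \geq \delta n$, and every coloring $f: E(G) \to [q]$, there is a $K_r$-tiling of $G$ whose discrepancy (with respect to $f$) is at least $\zeta n$. *)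

(* Defs.v *)
From mathcomp Require Import all_boot all_order all_algebra.
From mathcomp Require Import boolp classical_sets filter reals.

Set Implicit Arguments.
Unset Strict Implicit.
Unset Printing Implicit Defensive.

Import Order.TTheory GRing.Theory Num.Theory.

(* A simple graph on the vertex set V is an adjacency relation satisfying
   [simple_graph]; an edge xy is the two-element set [set x; y]. *)
Definition simple_graph (V : finType) (e : rel V) : Prop :=
  symmetric e /\ irreflexive e.

Definition edges (V : finType) (e : rel V) : {set {set V}} :=
  [set [set x; y] | x in [set: V], y in [set: V] & e x y].

(* The default value #|V| of the iterated minimum plays no role when V is
   nonempty, every degree being smaller than #|V|. *)
Definition min_degree (V : finType) (e : rel V) : nat :=
  \big[minn/#|V|]_(v : V) #|[set w | e v w]|.

(* A copy of K_r is determined by its set of vertices, so a K_r-tiling is given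
   by the partition of V into the vertex sets of its copies. *)
Definition is_Kr_copy (V : finType) (e : rel V) (r : nat) (B : {set V}) : bool :=
  (#|B| == r) && [forall x in B, forall y in B, (x != y) ==> e x y].

Definition is_Kr_tiling (V : finType) (e : rel V) (r : nat)
    (P : {set {set V}}) : bool :=
  finset.partition P [set: V] && [forall B in P, is_Kr_copy e r B].

(* The adjacency relation of the union of the complete graphs on the blocks. *)
Definition tiling_graph (V : finType) (P : {set {set V}}) : rel V :=
  [rel x y | (x != y) && [exists B in P, (x \in B) && (y \in B)]].

Local Open Scope ring_scope.
Local Open Scope classical_set_scope.

(* A q-edge-coloring of a graph on V is a function f : {set V} -> 'I_q, of which
   only the values on the edges of the graph are ever used.  The set below has a
   maximum as soon as q > 0, hence [sup] is the largest such t. *)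
Definition discrepancy (R : realType) (V : finType) (q : nat) (e : rel V)
    (f : {set V} -> 'I_q) : R :=
  sup [set t : R | exists c : 'I_q,
    (#|edges e|%:R + t) / q%:R <= #|[set E in edges e | f E == c]%SET|%:R].

Definition delta (R : realType) (r q : nat) : R :=
  inf [set d : R | 0 < d /\ exists zeta : R, 0 < zeta /\
    \forall n \near \oo, (r %| n)%N ->
      forall (V : finType) (e : rel V) (f : {set V} -> 'I_q),
        #|V| = n -> simple_graph e -> d * n%:R <= (min_degree e)%:R ->
        exists P : {set {set V}},
          is_Kr_tiling e r P /\
          zeta * n%:R <= discrepancy R (tiling_graph P) f].

(* Main.v *)
(* Upper bound.  Let the minimum degree exceed r n / (r + 1) by a linear amount.
   A gadget is a set of 2r vertices with two K_r-tilings whose colour counts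
   differ.  Given linearly many disjoint gadgets, some colour distinguishes
   linearly many of them; switching these and tiling the rest by the
   Hajnal-Szemeredi theorem gives two tilings whose counts of that colour are far
   apart, so one of the two is unbalanced.  Otherwise a few gadgets can be deleted
   so that none remains.  Then in every 4-cycle u a v b the opposite pairs
   {ua, vb} and {va, ub} carry the same multiset of colours.  As any four vertices
   have a common neighbour, this forces one colour on all the edges outside an
   independent set S.  Since |S| is below n / (r + 1), that colour is
   overrepresented in every tiling.

   Lower bound.  Take the complete (r + 1)-partite graph with equal parts.  Each
   pair of parts among the first r is monochromatic, and each vertex of the last
   part gives a single colour to all its edges.  In a K_r-tiling the number of
   copies missing a given part is fixed, so every colour count is determined by
   the colouring; the hypothesis on q is what allows all of them to be equal. *)
Require Import Defs.
From mathcomp Require Import all_boot all_order all_algebra.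
From mathcomp Require Import reals.
From mathcomp Require Import zify ring lra.

Set Implicit Arguments.
Unset Strict Implicit.
Unset Printing Implicit Defensive.

(** * The Hajnal-Szemeredi theorem *)

(** Discrepancy measures only excess, but with E edges in every tiling a colour that is scarce in
    one tiling makes another colour abundant there. So two tilings far apart in one colour suffice.

    The bound r / (r + 1) enters the upper bound twice. It says that any r + 1 vertices have a
    common neighbour, even outside a small linear set. This is what extends the four vertices of a
    4-cycle by r - 2 further vertices so as to form gadgets, and since r + 1 >= 4 it provides the
    common neighbours of four vertices. It also gives |S| < n / (r + 1). A copy of K_r has at most
    one vertex in S, so S meets at most (r - 1) |S| of the n (r - 1) / 2 edges of a tiling, a
    fraction below 2 / (r + 1) <= 1/2. For r = 3 and q = 2 the two halves would just balance at |S|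
    = n / 4; the linear surplus in the minimum degree decides.

    The Hajnal-Szemeredi theorem is applied to the complement graph: independent classes of size r
    there are copies of K_r. *)

Lemma card_set_sum (T : finType) (A : {set T}) (P : pred T) :
  #|[set x in A | P x]| = \sum_(x in A) P x.
Proof.
rewrite -sum1_card (eq_bigl (fun x => (x \in A) && P x)); last first.
  by move=> x; rewrite inE.
by rewrite big_mkcondr; apply: eq_bigr => x _; case: (P x).
Qed.

Lemma sumb_gt0P (T : finType) (A : {set T}) (P : pred T) :
  reflect (exists2 x, x \in A & P x) (0 < \sum_(x in A) P x).
Proof.
rewrite -card_set_sum; apply: (iffP card_gt0P) => [[x]|[x xA Px]].
  by rewrite inE => /andP[]; exists x.
by exists x; rewrite inE xA.
Qed.

Lemma sumb_eq0 (T : finType) (A : {set T}) (P : pred T) :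
  (\sum_(x in A) P x == 0) = [forall x in A, ~~ P x].
Proof.
rewrite sum_nat_eq0; apply: eq_forallb => x.
by case: (x \in A); case: (P x).
Qed.

(** The elements of [X] are coloured one at a time, always with a colour whose quota is still
    positive; [c0] is the value elsewhere. *)
Lemma exists_fibers (T C : finType) (c0 : C) (X : {set T}) (m : C -> nat) :
  \sum_c m c = #|X| ->
  exists g : T -> C, forall c, \sum_(x in X) (g x == c) = m c.
Proof.
elim: {X}#|X| {-2}X (erefl #|X|) m => [|n IH] X cX m sm.
  exists (fun=> c0) => c; have /eqP := cX; rewrite cards_eq0 => /eqP->.
  rewrite big_set0; move/eqP: sm; rewrite cX sum_nat_eq0 => /forallP/(_ c)/eqP.
  by move->.
have [x xX] : exists x, x \in X by apply/card_gt0P; rewrite cX.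
have [c mc] : exists c, 0 < m c.
  apply/existsP; apply: contraT; rewrite negb_exists => /forallP m0.
  by move: sm; rewrite big1 ?cX // => c _; have := m0 c; lia.
have [||g gP] := IH (X :\ x) _ (fun d => m d - (d == c)).
- by have := cardsD1 x X; rewrite xX cX; lia.
- rewrite (bigD1 c) //= (eq_bigr m) => [|d /negPf->]; last by rewrite subn0.
  by move: sm (cardsD1 x X); rewrite (bigD1 c) //= eqxx xX; lia.
exists (fun y => if y == x then c else g y) => d.
rewrite (big_setD1 x) //= eqxx (eq_bigr (fun y => (g y == d) : nat)) => [|y].
  by rewrite gP (eq_sym d); case: eqP => [<-|_] /=; lia.
by rewrite !inE => /andP[/negPf->].
Qed.

(** * Vertices whose removal cuts off no others in a directed graph *)

Section TerminalSet.
Variables (T : finType) (e : rel T).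

Definition avoiding (w : T) : rel T := [rel c d | [&& e c d, c != w & d != w]].

Lemma avoiding_sub w c d : avoiding w c d -> e c d.
Proof. by case/and3P. Qed.

Lemma connect_avoiding (e' : rel T) w x t :
    subrel e' e -> connect e' x t -> (forall c, connect e' c t -> c != w) ->
  connect (avoiding w) x t.
Proof.
move=> sub /connectP[p pp ->] H.
have {H}: forall c, connect e' c (last x p) -> c != w by [].
elim: p x pp => [|z p IH] x //= /andP[exz pp] H.
apply: (@connect_trans _ _ z); last exact: IH.
have zt : connect e' z (last z p) by apply/connectP; exists p.
apply: connect1; rewrite /avoiding /= sub //= !H //.
exact: connect_trans (connect1 exz) zt.
Qed.

(** A simple path never returns to its start, so edges into [x] need not survive in [e']. In the
    applications the start is a class that has just gained a vertex, and moves into it may have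
    become impossible. *)
Lemma path_uniq_target (e' : rel T) (x : T) (p : seq T) :
    path e x p -> uniq (x :: p) ->
    {in x :: p & p, forall c d, d != x -> e c d -> e' c d} ->
  path e' x p.
Proof.
move=> pp /= /andP[xp _] H; apply/(pathP x) => i hi.
apply: H; rewrite ?mem_nth //=; last by move/(pathP x): pp; apply.
- by rewrite ltnS ltnW.
- by apply: contra xp => /eqP <-; rewrite mem_nth.
Qed.

Lemma path_connect_last x p c :
  path e x p -> c \in x :: p -> connect e c (last x p).
Proof.
move=> pp; rewrite inE => /orP[/eqP->|cp]; first by apply/connectP; exists p.
case/splitPr: cp pp => p1 p2; rewrite cat_path last_cat /= => /and3P[_ _ pp].
by apply/connectP; exists p2.
Qed.

Lemma connect_sub_target (e' : rel T) x t :
    connect e x t -> (forall c d, connect e c t -> connect e d t ->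
      e c d -> e' c d) ->
  connect e' x t.
Proof.
case/connectP=> p pp -> H; elim: p x pp H => [|z p IHp] x //= /andP[xz pp] H.
have zt : connect e z (last z p) by apply/connectP; exists p.
apply: (@connect_trans _ _ z); last exact: IHp.
by apply/connect1/H => //; apply: connect_trans zt; apply: connect1.
Qed.

(* Choose u whose removal cuts off a smallest nonempty set S of vertices from t;
   then removing a vertex of S cuts off nothing. *)
Lemma exists_terminal_set (t : T) : (exists2 c, connect e c t & c != t) ->
  exists (u : T) (S : {set T}),
    [/\ S != set0, t \notin S,
        forall W, W \in S -> connect e W t /\
          forall X, connect e X t -> X != W -> connect (avoiding W) X t &
        forall W X, W \in S -> connect e X t -> X \notin S -> X != u ->
          ~~ e W X].
Proof.
case=> c1 c1t c1n.
(* [connect] is reflexive, so [t] would still reach itself after its own removal. The conjunct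
   [w != t] makes [bad t] the set of all other vertices that reach [t]. *)
pose reach w c := (w != t) && connect (avoiding w) c t.
pose bad w := [set c | [&& connect e c t, c != w & ~~ reach w c]].
have bt : bad t != set0.
  by apply/set0Pn; exists c1; rewrite inE c1t c1n /reach eqxx.
case: (@arg_minnP _ t (fun w => bad w != set0) (fun w => #|bad w|) bt).
move=> u bu umin.
have reachN w c : reach w c -> c != w.
  case/andP=> wt /connectP[[/= _ <-|d p /=]]; first by rewrite eq_sym.
  by case/andP=> /and3P[].
have t_bad : t \notin bad u.
  by rewrite inE /reach !connect0 andbT negbK eq_sym andNb.
(* A path to [t] that avoids [u] cannot meet [W], which would otherwise reach [t] without [u]. *)
have keep W X : W \in bad u -> reach u X -> reach W X.
  move=> Wb /andP[ut uX].
  have Wt : W != t by apply: contraNneq t_bad => <-.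
  rewrite /reach Wt /=; apply: (connect_avoiding _ uX).
    by move=> ? ? /avoiding_sub.
  move=> c ct; apply: contraTneq Wb => <-.
  by rewrite inE negb_and negb_and negbK /reach ut ct !orbT.
exists u, (bad u); split=> // W.
  move=> Wb; have := Wb; rewrite inE => /and3P[Wt Wu Wr]; split=> // X Xt XW.
  have WtN : W != t by apply: contraNneq t_bad => <-.
  suff /andP[] : reach W X by [].
  apply: contraT => XnW.
  have XbW : X \in bad W by rewrite inE Xt XW.
  have : #|bad u| <= #|bad W| by apply: umin; apply/set0Pn; exists X.
  (* This contradicts the minimality of [bad u], since [W] lies in [bad u] but not in [bad W]. *)
  suff sub : bad W \subset bad u :\ W.
    by have := subset_leq_card sub; have := cardsD1 W (bad u); rewrite Wb; lia.
  apply/subsetP => Y; rewrite !inE => /and3P[Yt YW YrW]; rewrite YW Yt /=.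
  have YrU : ~~ reach u Y by apply: contra YrW; apply: keep.
  (* It remains to see that [u] is not in [bad W]. The vertex after [u] on a simple path to [t]
     reaches [t] without [u], hence without [W] by [keep]. *)
  rewrite YrU andbT; apply: contraNneq YrW => Yu; subst Y.
  have [ut|ut] := eqVneq u t; first by rewrite ut /reach WtN connect0.
  case/connectP: Yt => p0 /shortenP[[|z p] pp up _] tE /=.
    by move: ut; rewrite tE eqxx.
  move: pp up tE => /= /andP[euz pp] /and3P[up _ _] tE.
  have rz : reach u z.
    rewrite /reach ut tE /=; apply/connectP; exists p => //.
    apply/(pathP z) => i hi; rewrite /avoiding /=.
    move/(pathP z): (pp) => /(_ i hi) -> /=.
    apply/andP; split; apply: contraNneq up => <-.
      by rewrite mem_nth //= ltnS ltnW.
    by rewrite in_cons mem_nth ?orbT.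
  have /andP[_ rWz] := keep _ _ Wb rz.
  rewrite /reach WtN; apply: connect_trans rWz; apply: connect1.
  rewrite /avoiding /= euz YW /=; apply: contraTneq Wb => <-.
  by rewrite inE rz /= !andbF.
move=> X; rewrite !inE => /and3P[Wt Wu Wr] Xt; rewrite Xt /= => Xr XU.
apply: contra Wr => eWX.
move: Xr; rewrite XU /= negbK /reach => /andP[-> H] /=.
by apply: connect_trans H; apply: connect1; rewrite /avoiding /= eWX Wu XU.
Qed.

End TerminalSet.

Ltac alia := intros; repeat match goal with
  | H : ?P |- _ => lazymatch type of P with Prop => lazymatch P with
    | @eq nat _ _ => fail
    | is_true (leq _ _) => fail
    | is_true (~~ (leq _ _)) => fail
    | _ => clear H end end end; lia.

(** * Equitable colourings and moves between classes *)

Section Colouring.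
Variables (V C : finType) (h : rel V).
Hypotheses (hsym : symmetric h) (hirr : irreflexive h).
Implicit Types (U : {set V}) (K : {set C}) (phi : V -> C) (x y : V) (c d : C).

Definition degree_in U x := \sum_(y in U) h x y.
Definition class_size phi U c := \sum_(x in U) (phi x == c).
Definition degree_to phi U x c := \sum_(y in U) (h x y && (phi y == c)).
Definition proper phi U := {in U &, forall x y, h x y -> phi x != phi y}.
(** The factor [(d \in K)] also makes all classes outside [K] empty, so [U] is coloured by [K]
    alone. *)
Definition equitable phi U K s :=
  proper phi U /\ forall d, class_size phi U d = (d \in K) * s.
Definition movable phi U : rel C :=
  [rel c d | [exists x in U, (phi x == c) && (degree_to phi U x d == 0)]].

Lemma degree_inE phi U x : degree_in U x = \sum_c degree_to phi U x c.
Proof.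
rewrite /degree_in /degree_to exchange_big; apply: eq_bigr => y _ /=.
rewrite (bigD1 (phi y)) //= eqxx andbT big1 ?addn0 // => c /negPf.
by rewrite eq_sym => ->; rewrite andbF.
Qed.

Lemma class_size_sum phi U (K : {set C}) :
  \sum_(c in K) class_size phi U c = #|[set x in U | phi x \in K]|.
Proof.
rewrite card_set_sum /class_size exchange_big; apply: eq_bigr => y _ /=.
case: (boolP (phi y \in K)) => yK.
  by rewrite (bigD1 (phi y)) //= eqxx big1 // => c /andP[_ /negPf]; rewrite eq_sym => ->.
by rewrite big1 // => c cK; case: eqP => // E; rewrite E cK in yK.
Qed.

Lemma degree_to_eq0 phi U x c : degree_to phi U x c = 0 ->
  forall y, y \in U -> h x y -> phi y != c.
Proof.
move/eqP; rewrite sumb_eq0 => /forall_inP H y yU xy.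
by have := H y yU; rewrite xy.
Qed.

Lemma degree_to_gt0 phi U x c :
  reflect (exists2 y, y \in U & h x y && (phi y == c)) (0 < degree_to phi U x c).
Proof. exact: sumb_gt0P. Qed.

Lemma exists_free_class phi U K x : degree_in U x < #|K| ->
  exists2 c, c \in K & degree_to phi U x c = 0.
Proof.
move=> lt; case: (boolP [exists c in K, degree_to phi U x c == 0]).
  by case/exists_inP=> c cK /eqP; exists c.
rewrite negb_exists_in => /forall_inP H; move: lt; rewrite ltnNge => /negP[].
rewrite (degree_inE phi) -sum1_card [X in _ <= X](bigID (mem K)) /=.
by apply/leq_trans/leq_addr/leq_sum => c /H; rewrite lt0n.
Qed.

Lemma class_size_gt0 phi U c x : x \in U -> phi x = c -> 0 < class_size phi U c.
Proof. by move=> xU E; apply/sumb_gt0P; exists x; rewrite ?E. Qed.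

Lemma class_size_ext phi psi U c : {in U, phi =1 psi} ->
  class_size phi U c = class_size psi U c.
Proof. by move=> E; apply: eq_bigr => x /E ->. Qed.

Lemma class_sizeD1 phi U c x : x \in U ->
  class_size phi U c = (phi x == c) + class_size phi (U :\ x) c.
Proof. by move=> xU; rewrite /class_size (big_setD1 x). Qed.

Lemma class_sizeU phi U1 U2 c : [disjoint U1 & U2] ->
  class_size phi (U1 :|: U2) c = class_size phi U1 c + class_size phi U2 c.
Proof. move=> D; rewrite /class_size -bigU //=.
by apply: eq_bigl => x; rewrite !inE. Qed.

Definition recolour phi x c := fun y => if y == x then c else phi y.

Lemma class_size_recolour phi U x c d : x \in U ->
  class_size (recolour phi x c) U d + (d == phi x) =
  class_size phi U d + (d == c).
Proof.
move=> xU; rewrite !(class_sizeD1 _ _ xU) /recolour eqxx.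
rewrite (@class_size_ext _ phi (U :\ x)); last by move=> y /=; rewrite !inE => /andP[/negPf->].
by rewrite (eq_sym c) (eq_sym d (phi x)); alia.
Qed.

Lemma properS phi U1 U2 : U1 \subset U2 -> proper phi U2 -> proper phi U1.
Proof. by move=> /subsetP S P x y /S xU /S yU; apply: P. Qed.

Lemma proper_recolour phi U x c : proper phi (U :\ x) ->
  degree_to phi U x c = 0 -> proper (recolour phi x c) U.
Proof.
move=> P /degree_to_eq0 F y z yU zU yz; rewrite /recolour.
have [Ey|yx] := eqVneq y x; have [Ez|zx] := eqVneq z x.
- by rewrite Ey Ez hirr in yz.
- by rewrite eq_sym F // -Ey.
- by rewrite F // -Ez hsym.
- by apply: P; rewrite ?inE ?yx ?zx.
Qed.

Lemma degree_to_uniq phi U x c y z : degree_to phi U x c = 1 ->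
  y \in U -> z \in U -> h x y -> h x z -> phi y = c -> phi z = c -> y = z.
Proof.
rewrite /degree_to -card_set_sum => /eqP/cards1P[w E] yU zU xy xz yc zc.
have /set1P-> : y \in [set w] by rewrite -E inE yU xy yc eqxx.
by have /set1P-> : z \in [set w] by rewrite -E inE zU xz zc eqxx.
Qed.

(* Shift one vertex along each edge of a simple path of classes. *)
Lemma shift_classes phi U c p :
    path (movable phi U) c p -> uniq (c :: p) -> proper phi U ->
  exists psi, proper psi U /\ forall d,
    class_size psi U d + (d == c) = class_size phi U d + (d == last c p).
Proof.
elim: p c phi => [|d p IH] c phi /=; first by move=> _ _ P; exists phi.
case/andP=> /exists_inP[x xU /andP[/eqP xc /eqP xd]] pp up P.
have /andP[cdp udp] := up.
have P1 := proper_recolour (properS (subsetDl _ _) P) xd.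
have [|psi [Ppsi S]] := IH d _ _ udp P1.
  (* The shifted vertex leaves [c], which is not on the remaining path, and enters [d], which is
     never a target there. The other moves therefore persist. *)
  apply: path_uniq_target pp udp _ => a b adp bp bd.
  have bc : c != b by apply: contraNneq cdp => ->; rewrite inE bp orbT.
  have ac : c != a by apply: contraNneq cdp => ->.
  case/exists_inP=> y yU /andP[ya yb]; apply/exists_inP; exists y => //.
  have yx : y != x by apply: contraNneq ac => yx; rewrite -xc -yx (eqP ya).
  rewrite {1}/recolour (negPf yx) ya /=.
  move: yb; rewrite !sumb_eq0 => /forall_inP H; apply/forall_inP => z zU.
  rewrite /recolour; have [_|_] := eqVneq z x; last exact: H.
  by rewrite eq_sym (negPf bd) andbF.
exists psi; split=> // b; have := S b; have := class_size_recolour phi d b xU.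
by rewrite xc; alia.
Qed.

Lemma equitable_mem phi U K s x : equitable phi U K s -> x \in U -> phi x \in K.
Proof.
case=> _ S xU; have := class_size_gt0 xU (erefl (phi x)); rewrite S.
by case: (phi x \in K).
Qed.

Lemma equitable_glue phi1 phi2 U1 U2 K1 K2 s :
    equitable phi1 U1 K1 s -> equitable phi2 U2 K2 s ->
    [disjoint U1 & U2] -> [disjoint K1 & K2] ->
  equitable (fun x => if x \in U1 then phi1 x else phi2 x) (U1 :|: U2)
    (K1 :|: K2) s.
Proof.
move=> E1 E2 DU DK; have [P1 S1] := E1; have [P2 S2] := E2; split.
  move=> x y; rewrite !in_setU => xU yU xy.
  case: (boolP (x \in U1)) xU => xU1 /= xU; case: (boolP (y \in U1)) yU => yU1 /= yU.
  - exact: P1.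
  - have := equitable_mem E1 xU1; have := equitable_mem E2 yU.
    by move=> yK xK; apply: contraTneq yK => <-; rewrite (disjointFr DK).
  - have := equitable_mem E2 xU; have := equitable_mem E1 yU1.
    by move=> yK xK; apply: contraTneq xK => ->; rewrite (disjointFr DK).
  - exact: P2.
move=> d; rewrite class_sizeU // in_setU.
rewrite (@class_size_ext _ phi1 U1); last by move=> x ->.
rewrite (@class_size_ext _ phi2 U2); last first.
  by move=> x xU2 /=; rewrite (disjointFl DU).
rewrite S1 S2; case: (boolP (d \in K1)) => dK1 /=; last by rewrite mul0n.
by rewrite (disjointFr DK) // mul0n addn0.
Qed.

(** Class [a] is one short and class [b] one over. Both corrections are added, which avoids
    truncated subtraction and includes [a = b], the equitable case. *)
Definition nearly_equitable phi U K s a b :=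
  [/\ proper phi U, a \in K, b \in K &
      forall d, class_size phi U d + (d == a) = (d \in K) * s + (d == b)].

(* The argument of Kierstead and Kostochka.  A class is accessible when vertices
   can be shifted along a path of classes from it to the deficient class a. *)
Section Step.
Variables (U : {set V}) (K : {set C}) (s : nat).
Hypothesis deg : forall x, x \in U -> degree_in U x < #|K|.
Hypothesis IH : forall (U' : {set V}) (K' : {set C}), #|K'| < #|K| ->
  #|U'| = #|K'| * s -> (forall x, x \in U' -> degree_in U' x < #|K'|) ->
  exists psi, equitable psi U' K' s.

Section Near.
Variables (phi : V -> C) (a b : C).
Hypothesis near : nearly_equitable phi U K s a b.

Let A := [set c | connect (movable phi U) c a].
Let B := [set x in U | phi x \notin A].
Let AU := [set x in U | phi x \in A].

Lemma near_size d : class_size phi U d + (d == a) = (d \in K) * s + (d == b).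
Proof. by case: near. Qed.

Lemma near_mem x : x \in U -> phi x \in K.
Proof.
move=> xU; have [_ _ bK _] := near; have := near_size (phi x).
have := class_size_gt0 xU (erefl (phi x)); case: (boolP (phi x \in K)) => //= xK.
by have [E|_] := eqVneq (phi x) b; [rewrite E bK in xK | alia].
Qed.

Lemma base_accessible : a \in A.
Proof. by rewrite inE connect0. Qed.

Lemma not_base d : d \notin A -> d != a.
Proof. by apply: contraNneq => ->; exact: base_accessible. Qed.

Lemma accessible_sub : A \subset K.
Proof.
have [_ aK _ _] := near.
apply/subsetP => c; rewrite inE => /connectP[[|d p] /=]; first by move=> _ <-.
by case/andP=> /exists_inP[x xU /andP[/eqP <- _]] _ _; apply: near_mem.
Qed.

Lemma accessible_large : b \in A -> exists psi, equitable psi U K s.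
Proof.
rewrite inE => /connectP[p0 /shortenP[p pp up _] aE].
have [P _ _ _] := near; have [psi [P' S]] := shift_classes pp up P.
by exists psi; split=> // d; have := S d; have := near_size d; rewrite -aE; alia.
Qed.

Hypothesis bA : b \notin A.

(** A vertex without a neighbour in an accessible class could move there, which would make its own
    class accessible. *)
Lemma B_degree_to y c : y \in B -> c \in A -> 0 < degree_to phi U y c.
Proof.
rewrite !inE => /andP[yU yA] cA; rewrite lt0n; apply: contra yA => y0.
by apply: connect_trans (connect1 _) cA; apply/exists_inP; exists y; rewrite ?eqxx.
Qed.

Lemma class_size_A d : d \in A -> class_size phi U d + (d == a) = s.
Proof.
move=> dA; rewrite near_size (subsetP accessible_sub) // mul1n.
by case: eqP (bA) => [<-|]; rewrite ?dA ?addn0.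
Qed.

Lemma class_size_AU d : class_size phi AU d = (d \in A) * class_size phi U d.
Proof.
rewrite /class_size big_distrr [RHS](big_setID AU) /= [X in _ = _ + X]big1 ?addn0.
  rewrite (setIidPr _); last by apply/subsetP => x; rewrite inE => /andP[].
  apply: eq_bigr => x; rewrite inE => /andP[_].
  by case: eqP => [<- ->|]; rewrite ?muln0.
move=> x; rewrite !inE negb_and => /andP[/orP[/negPf->//|] /[swap] xU].
by case: eqP => [<- /negPf->|]; rewrite ?muln0.
Qed.

Lemma card_B : #|B| = #|K :\: A| * s + 1.
Proof.
have -> : B = [set x in U | phi x \in K :\: A].
  apply/setP => x; rewrite [RHS]inE [LHS]inE in_setD.
  by case: (boolP (x \in U)) => //= xU; rewrite near_mem // andbT.
rewrite -class_size_sum -sum_nat_const.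
have [_ aK bK _] := near.
have bKA : b \in K :\: A by rewrite inE bA.
rewrite (bigD1 b) //= [X in _ = X + _](bigD1 b) //= -addnA [_ + 1]addnC addnA.
congr (_ + _); last first.
  apply: eq_bigr => c; rewrite inE => /andP[/andP[cA cK] /negPf cb].
  have := near_size c; rewrite cK cb.
  by case: eqP cA => [->|_ _]; [rewrite base_accessible | alia].
have := near_size b; rewrite bK eqxx.
by case: eqP (bA) => [->|_ _]; [rewrite base_accessible | alia].
Qed.

Lemma card_KA : #|K :\: A| + #|A| = #|K|.
Proof. by rewrite -(cardsID A K) (setIidPr accessible_sub) addnC. Qed.

Lemma degree_split x :
  degree_in U x = \sum_(c in A) degree_to phi U x c + degree_in B x.
Proof.
rewrite (degree_inE phi) (bigID (mem A)) /=; congr (_ + _).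
rewrite /degree_to exchange_big /= /degree_in [RHS]big_mkcond [LHS]big_mkcond /=.
apply: eq_bigr => y _; rewrite inE; case: (y \in U) => //=.
case: (boolP (phi y \in A)) => yA /=.
  by rewrite big1 // => c cA; case: eqP => [E|]; [rewrite -E yA in cA | rewrite andbF].
rewrite (bigD1 (phi y)) //= eqxx andbT big1 ?addn0 // => c /andP[_ /negPf].
by rewrite eq_sym => ->; rewrite andbF.
Qed.

Lemma B_degree y : y \in B -> degree_in B y + #|A| < #|K|.
Proof.
move=> yB; have yU : y \in U by move: yB; rewrite inE => /andP[].
apply: leq_ltn_trans (deg yU); rewrite degree_split addnC leq_add2r -sum1_card.
by apply: leq_sum => c cA; apply: B_degree_to.
Qed.

(** The extra vertex of the class [b] lies in [B], so [B] without any one vertex has exactly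
    [#|K :\: A| * s] elements. Each of them spends at least [#|A|] of its degree on accessible
    classes, so the induction hypothesis applies. *)
Lemma B_recolour y : y \in B ->
  exists psi, equitable psi (B :\ y) (K :\: A) s.
Proof.
move=> yB; apply: IH.
- have := card_KA; have : 0 < #|A|; last by alia.
  by apply/card_gt0P; exists a; apply: base_accessible.
- by have := card_B; rewrite (cardsD1 y) yB; alia.
move=> x /setD1P[xy xB]; have := B_degree xB; have := card_KA.
suff : degree_in (B :\ y) x <= degree_in B x by alia.
by rewrite /degree_in (big_setD1 y yB) leq_addl.
Qed.

Lemma AU_B_disjoint : [disjoint AU & B].
Proof.
by rewrite disjoint_subset; apply/subsetP => x; rewrite !inE => /andP[-> ->].
Qed.

Lemma AU_B_cover : AU :|: B = U.
Proof. by apply/setP => x; rewrite !inE; case: (x \in U); rewrite //= orbN. Qed.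

(** Move [z] to [X] and put [y] in its place: [z] was the only neighbour of [y] in that class. The
    surplus in [X] is then shifted to [a] along classes other than [phi z], and the rest of [B] is
    recoloured by [B_recolour] with the remaining colours. *)
Lemma solo_movable z y X :
    y \in B -> z \in U -> h y z -> degree_to phi U y (phi z) = 1 ->
    phi z \in A -> X \in A -> X != phi z -> degree_to phi U z X = 0 ->
    connect (avoiding (movable phi U) (phi z)) X a ->
  exists psi, equitable psi U K s.
Proof.
move=> yB zU yz y1 zA XA XW zX Xa.
have [yU yA] : y \in U /\ phi y \notin A by move: yB; rewrite [in y \in B]inE => /andP[].
have [P _ _ _] := near.
have zy : z != y by apply: contraNneq yA => <-.
have [g gE] := B_recolour yB.
pose phi' := recolour phi z X; pose phi1 := recolour phi' y (phi z).
have P' : proper phi' U by apply: proper_recolour zX; apply: properS P; apply: subsetDl.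
have P1 : proper phi1 U.
  apply: proper_recolour; first by apply: properS P'; apply: subsetDl.
  apply/eqP; rewrite sumb_eq0; apply/forall_inP => x xU; apply/negP => /andP[yx].
  rewrite /phi' /recolour; case: (eqVneq x z) => [_|xz]; first by rewrite (negPf XW).
  by move=> /eqP xW; rewrite (degree_to_uniq y1 xU zU yx yz xW erefl) eqxx in xz.
have yAU : y \notin AU by rewrite inE (negPf yA) andbF.
have zAU : z \in AU by rewrite inE zU.
pose U1 := y |: AU.
have sU1 : U1 \subset U.
  by rewrite subUset sub1set yU; apply/subsetP => x; rewrite inE => /andP[].
have S1 d : class_size phi1 U1 d + (d == a) = (d \in A) * s + (d == X).
  rewrite (class_sizeD1 _ _ (setU11 y AU)) setU1K //.
  rewrite (@class_size_ext _ phi' AU); last first.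
    by move=> x xA; rewrite /phi1 /recolour; case: eqP => // E; rewrite -E xA in yAU.
  have := class_size_recolour phi X d zAU; rewrite class_size_AU -/phi'.
  rewrite /phi1 /recolour eqxx (eq_sym _ d).
  case: (boolP (d \in A)) => [/class_size_A|dA]; first by alia.
  by rewrite (negPf (not_base dA)); alia.
case/connectP: Xa => p0 /shortenP[p pp up _] aE.
(* Only [X] and [phi z] have gained vertices. The path avoids [phi z] and never targets its start
   [X], so its moves persist. *)
have [|psi [Ppsi S]] := shift_classes (phi := phi1) (U := U1) (p := p) _ up (properS sU1 P1).
  apply: (path_uniq_target pp up) => c d cp dp dX /and3P[cd cW dW].
  have pm : path (movable phi U) X p.
    by apply: sub_path pp => ? ? /avoiding_sub.
  have cA : c \in A by rewrite inE aE; apply: path_connect_last pm cp.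
  case/exists_inP: cd => x xU /andP[/eqP xc /eqP xd].
  have xy : x != y by apply: contraNneq yA => <-; rewrite xc.
  have xz : x != z by apply: contraNneq cW => <-; rewrite xc.
  apply/exists_inP; exists x; first by apply: setU1r; rewrite [x \in _]inE xU xc.
  rewrite /phi1 /phi' {1}/recolour (negPf xy) {1}/recolour (negPf xz) xc eqxx /=.
  rewrite sumb_eq0; apply/forall_inP => v /(subsetP sU1) vU.
  rewrite negb_and -implybE; apply/implyP => xv; rewrite /recolour.
  case: (eqVneq v y) => _; first by rewrite eq_sym.
  case: (eqVneq v z) => _; first by rewrite eq_sym.
  exact: degree_to_eq0 xd v vU xv.
have E1 : equitable psi U1 A s.
  by split=> // d; have := S d; have := S1 d; rewrite -aE; alia.
have DU : [disjoint U1 & B :\ y].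
  rewrite disjoint_subset; apply/subsetP => x; rewrite !inE.
  by case: (x == y) => //=; case: (x \in U) => //= ->.
have DK : [disjoint A & K :\: A].
  by rewrite disjoints_subset; apply/subsetP => x xA; rewrite in_setC in_setD xA.
have E := equitable_glue E1 gE DU DK.
have UE : U1 :|: B :\ y = U.
  by rewrite -AU_B_cover /U1 setUAC setD1K // setUC.
have KE : A :|: K :\: A = K.
  by rewrite -{1}(setIidPr accessible_sub) setID.
by rewrite UE KE in E; eexists; apply: E.
Qed.

(** Here [z] goes to an inaccessible class [Y] and [y1] takes its place. All accessible classes stay
    accessible, and so becomes the class of [y2]: its only neighbour in the class of [z] has left,
    and the newcomer [y1] is not adjacent to it. The surplus is now in [Y]. *)
Lemma solo_swap z y1 y2 :
    y1 \in B -> y2 \in B -> y1 != y2 -> ~~ h y1 y2 ->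
    z \in U -> phi z \in A -> phi z != a -> h y1 z -> h y2 z ->
    degree_to phi U y1 (phi z) = 1 -> degree_to phi U y2 (phi z) = 1 ->
    (forall X, X \in A -> X != phi z -> 0 < degree_to phi U z X /\
      connect (avoiding (movable phi U) (phi z)) X a) ->
  exists psi c, nearly_equitable psi U K s a c /\
    #|A| < #|[set c | connect (movable psi U) c a]|.
Proof.
move=> y1B y2B y12 y1y2 zU zA Wa y1z y2z d1 d2 term.
have [P aK _ _] := near.
have BU x : x \in B -> x \in U /\ phi x \notin A by rewrite [in x \in B]inE => /andP[].
have [y1U y1A] := BU _ y1B; have [y2U y2A] := BU _ y2B.
have zy1 : z != y1 by apply: contraNneq y1A => <-.
have zy2 : z != y2 by apply: contraNneq y2A => <-.
have zAU : z \in AU by rewrite inE zU.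
have zB : z \notin B by rewrite inE zA andbF.
have [g gE] := B_recolour y1B; have [Pg Sg] := gE.
have gK x : x \in B :\ y1 -> g x \in K /\ g x \notin A.
  by move=> /(equitable_mem gE); rewrite in_setD => /andP[].
(* The vertex [z] has a neighbour in each of the other [#|A| - 1] accessible classes and is adjacent
   to [y1]. Hence fewer than [#|K :\: A|] neighbours remain in [B :\ y1]. *)
have [Y YKA Yz] : exists2 Y, Y \in K :\: A & degree_to g (B :\ y1) z Y = 0.
  apply: exists_free_class.
  have := deg zU; rewrite degree_split.
  have : #|A :\ phi z| <= \sum_(c in A) degree_to phi U z c.
    rewrite (big_setD1 (phi z)) //= -sum1_card.
    apply: leq_trans (leq_addl _ _); apply: leq_sum => c /setD1P[cz cA].
    by have [] := term c cA cz.
  have := cardsD1 (phi z) A; have := card_KA; rewrite zA.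
  by rewrite [degree_in B z](big_setD1 y1) //= hsym y1z -/(degree_in _ _); alia.
have [YK YA] : Y \in K /\ Y \notin A by move: YKA; rewrite in_setD => /andP[].
have YW : Y != phi z by apply: contraNneq YA => ->.
pose phi0 := fun x => if x \in AU then phi x else g x.
have AUU x : x \in AU -> x \in U /\ phi x \in A by rewrite [in x \in AU]inE => /andP[].
have U1E x : x \in U -> x != y1 -> x \notin AU -> x \in B :\ y1.
  by move=> xU xy; rewrite -AU_B_cover in_setU in xU; case/orP: xU => [->//|xB]; rewrite in_setD1 xy.
have P0 : proper phi0 (U :\ y1).
  move=> x v /setD1P[xy xU] /setD1P[vy vU] xv; rewrite /phi0.
  case: (boolP (x \in AU)) => xA; case: (boolP (v \in AU)) => vA.
  - exact: P.
  - have [_ gv] := gK _ (U1E _ vU vy vA); have [_ px] := AUU _ xA.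
    by apply: contraNneq gv => <-.
  - have [_ gv] := gK _ (U1E _ xU xy xA); have [_ px] := AUU _ vA.
    by apply: contraNneq gv => ->.
  - by apply: Pg => //; apply: U1E.
pose phi1 := recolour phi0 z Y; pose phi2 := recolour phi1 y1 (phi z).
have P1 : proper phi1 (U :\ y1).
  apply: proper_recolour; first by apply: properS P0; apply: subsetDl.
  apply/eqP; rewrite sumb_eq0; apply/forall_inP => v /setD1P[vy vU].
  apply/negP => /andP[zv]; rewrite /phi0; case: (boolP (v \in AU)) => vA.
    by have [_ pv] := AUU _ vA; move/eqP=> E; rewrite -E pv in YA.
  by move/eqP; apply/eqP; apply: degree_to_eq0 Yz v (U1E _ vU vy vA) zv.
(* The only vertex coloured phi z adjacent to y1 or y2 was z. *)
have free y : y \in B -> ~~ h y y1 -> h y z -> degree_to phi U y (phi z) = 1 ->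
    forall v, v \in U -> v != y1 -> h y v -> phi1 v != phi z.
  move=> yB yy1 yz y1' v vU vy yv; rewrite /phi1 /recolour /phi0.
  case: (eqVneq v z) => [//|vz]; case: (boolP (v \in AU)) => vA.
    apply: contraNneq vz => E.
    by rewrite (degree_to_uniq y1' vU zU yv yz E erefl).
  by have [_ gv] := gK _ (U1E _ vU vy vA); apply: contraNneq gv => ->.
have P2 : proper phi2 U.
  apply: proper_recolour => //.
  apply/eqP; rewrite sumb_eq0; apply/forall_inP => v vU; apply/negP => /andP[yv].
  by apply/negP/(free y1) => //; rewrite ?hirr //; apply: contraTneq yv => ->; rewrite hirr.
have phi2A v d : v \in U -> d \in A -> d != phi z -> phi2 v == d -> phi v == d.
  move=> vU dA dz; rewrite /phi2 /phi1 /phi0 /recolour.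
  case: (eqVneq v y1) => [_|vy]; first by rewrite eq_sym (negPf dz).
  case: (eqVneq v z) => [_|vz]; first by move/eqP=> E; rewrite -E (negPf YA) in dA.
  case: (boolP (v \in AU)) => // vA /eqP E.
  by have [_] := gK _ (U1E _ vU vy vA); rewrite E dA.
have phi2E v : v \in AU -> v != z -> phi2 v = phi v.
  move=> vA vz; rewrite /phi2 /phi1 /phi0 /recolour (negPf vz) vA.
  by case: (eqVneq v y1) vA => [->|//]; rewrite inE (negPf y1A) andbF.
have mv c d x : x \in U -> phi x = c -> x != z -> c \in A -> d \in A -> d != phi z ->
    degree_to phi U x d = 0 -> movable phi2 U c d.
  move=> xU xc xz cA dA dz xd; apply/exists_inP; exists x => //.
  have xAU : x \in AU by rewrite [x \in _]inE xU xc.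
  rewrite phi2E // xc eqxx /=.
  rewrite sumb_eq0; apply/forall_inP => v vU; apply/negP => /andP[xv] vd.
  by have /eqP := degree_to_eq0 xd vU xv; apply; apply/eqP/phi2A.
have accA X : X \in A -> X != phi z -> connect (movable phi2 U) X a.
  move=> XA Xz; have [_ Xa] := term X XA Xz.
  apply: (connect_sub_target Xa) => c d ca da /and3P[/exists_inP[x xU /andP[/eqP xc /eqP xd]] cz dz].
  have sub e : connect (avoiding (movable phi U) (phi z)) e a -> e \in A.
    by rewrite inE; apply: connect_sub => ? ? /avoiding_sub ?; apply: connect1.
  have xz : x != z by apply: contraNneq cz => <-; rewrite xc.
  exact: mv xU xc xz (sub _ ca) (sub _ da) dz xd.
(* The first move on an old path from [phi z] is not made by [z], which has neighbours in all other
   accessible classes; so it is still available. *)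
have accW : connect (movable phi2 U) (phi z) a.
  move: (zA); rewrite inE => /connectP[p0 /shortenP[[|X p] /= pp up _] aE].
    by rewrite aE eqxx in Wa.
  case/andP: pp => /exists_inP[x xU /andP[/eqP xc /eqP xd]] pp.
  have Xz : X != phi z by move: up; rewrite inE eq_sym negb_or => /andP[/andP[]].
  have XA : X \in A by rewrite inE; apply/connectP; exists p.
  apply: (connect_trans _ (accA X XA Xz)); apply: connect1; apply: (mv _ _ x) => //.
  by apply/eqP => E; have [] := term X XA Xz; rewrite -E xd.
have y2B1 : y2 \in B :\ y1 by rewrite in_setD1 eq_sym y12.
have [gy2K gy2A] := gK _ y2B1.
have accg : connect (movable phi2 U) (g y2) a.
  apply: (connect_trans _ accW); apply: connect1; apply/exists_inP; exists y2 => //.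
  have -> : phi2 y2 = g y2.
    rewrite /phi2 /phi1 /phi0 /recolour [y2 == y1]eq_sym (negPf y12).
    by rewrite [y2 == z]eq_sym (negPf zy2) [y2 \in _]inE (negPf y2A) andbF.
  rewrite eqxx /=.
  rewrite sumb_eq0; apply/forall_inP => v vU; apply/negP => /andP[yv].
  rewrite /phi2 /recolour; case: (eqVneq v y1) => [E|vy].
    by move: yv; rewrite E hsym (negPf y1y2).
  by apply/negP/(free y2) => //; rewrite hsym.
exists phi2, Y; split; last first.
  have sub : g y2 |: A \subset [set c | connect (movable phi2 U) c a].
    apply/subsetP => X /setU1P[->|XA]; first by rewrite inE.
    by rewrite inE; case: (eqVneq X (phi z)) => [->//|]; apply: accA.
  by have := subset_leq_card sub; rewrite cardsU1 gy2A add1n.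
split=> // d.
rewrite (class_sizeD1 _ _ y1U) /phi2 {1}/recolour eqxx.
rewrite (@class_size_ext _ phi1 (U :\ y1)); last first.
  by move=> x /setD1P[xy _]; rewrite /recolour (negPf xy).
have zU1 : z \in U :\ y1 by rewrite in_setD1 zy1.
have := class_size_recolour phi0 Y d zU1.
have -> : U :\ y1 = AU :|: B :\ y1.
  rewrite -AU_B_cover setDUl; congr (_ :|: _); apply/setDidPl.
  by rewrite disjoint_sym disjoints1 inE (negPf y1A) andbF.
have D : [disjoint AU & B :\ y1] by apply: disjointWr AU_B_disjoint; apply: subsetDl.
rewrite [class_size phi0 _ _]class_sizeU //.
rewrite (@class_size_ext phi0 phi AU); last by move=> x xA; rewrite /phi0 xA.
rewrite (@class_size_ext phi0 g (B :\ y1)); last by move=> x xB; rewrite /phi0 (disjointFl D).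
rewrite class_size_AU Sg in_setD -/phi1 {1}/phi0 zAU (eq_sym _ d).
case: (boolP (d \in A)) => [dA|dA] /=.
  by rewrite (subsetP accessible_sub) //; have := class_size_A dA; alia.
by rewrite (negPf (not_base dA)); alia.
Qed.

Lemma degree_in_B x : degree_in B x <= degree_in U x.
Proof.
rewrite /degree_in [X in X <= _]big_mkcond [X in _ <= X]big_mkcond.
by apply: leq_sum => y _; rewrite inE; case: (y \in U); case: (phi y \in A).
Qed.

Lemma weighted_degree (w : V -> nat) c :
  \sum_(y in B) \sum_(x in U) (h y x && (phi x == c)) * w x =
  \sum_(x in U) (phi x == c) * (w x * degree_in B x).
Proof.
rewrite exchange_big; apply: eq_bigr => x _ /=.
rewrite mulnA /degree_in big_distrr /=; apply: eq_bigr => y _.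
by rewrite hsym; case: (h x y); case: (phi x == c); rewrite ?muln1 ?muln0 ?mul0n ?mul1n.
Qed.

(** Double counting of the edges between [B] and the class [c], an edge at the vertex [x] of the
    class having weight [w x]. *)
Lemma leq_weighted (w : V -> nat) c l k :
    (forall y, y \in B -> l <= \sum_(x in U) (h y x && (phi x == c)) * w x) ->
    (forall x, x \in U -> phi x = c -> w x * degree_in B x <= k) ->
  #|B| * l <= class_size phi U c * k.
Proof.
move=> Hl Hk; rewrite -sum_nat_const.
apply: (@leq_trans (\sum_(x in U) (phi x == c) * k)); last first.
  by rewrite /class_size big_distrl.
apply: (@leq_trans (\sum_(y in B) \sum_(x in U) (h y x && (phi x == c)) * w x)).
  by apply: leq_sum => y /Hl.
rewrite weighted_degree; apply: leq_sum => x xU.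
by case: eqP => [/(Hk _ xU)|_]; rewrite ?mul1n.
Qed.

(** If [a] were the only accessible class, each of the [(#|K| - 1) * s + 1] vertices of [B] would
    have a neighbour among its [s - 1] vertices, whose degrees are at most [#|K| - 1]. *)
Lemma accessible_nontrivial : exists2 c, connect (movable phi U) c a & c != a.
Proof.
case: (boolP [exists c in A, c != a]) => [/exists_inP[c]|].
  by rewrite inE => ca cna; exists c.
rewrite negb_exists_in => /forall_inP Aa; exfalso.
have A1 : #|A| = 1.
  suff -> : A = [set a] by rewrite cards1.
  apply/setP => c; rewrite in_set1; apply/idP/eqP => [cA|->].
    by apply/eqP; rewrite -[_ == _]negbK Aa.
  exact: base_accessible.
have := @leq_weighted (fun=> 1) a 1 (#|K| - 1).
have := class_size_A base_accessible; have := card_B; have := card_KA.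
rewrite A1 eqxx muln1 => c1 c2 c3 H.
have {H} : #|B| <= class_size phi U a * (#|K| - 1).
  apply: H => [y yB|x xU _].
    under eq_bigr do rewrite muln1.
    exact: B_degree_to base_accessible.
  by rewrite mul1n; have := deg xU; have := degree_in_B x; alia.
rewrite c2 -c3 -c1 addnK mulnDr; alia.
Qed.

(** If some [z] in a class of the terminal set [S] is the unique neighbour, in its class, of a
    vertex of [B] and can move to another accessible class, [solo_movable] finishes. Otherwise
    counting yields two nonadjacent vertices of [B] sharing such a [z], and [solo_swap] enlarges the
    accessible set. *)
Lemma nearly_equitable_step :
  (exists psi, equitable psi U K s) \/
  exists psi c, nearly_equitable psi U K s a c /\
    #|A| < #|[set c | connect (movable psi U) c a]|.
Proof.
have [u [S [S0 aS term edge]]] := exists_terminal_set accessible_nontrivial.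
have SA c : c \in S -> c \in A by move=> /term[]; rewrite inE.
have sSA : S \subset A by apply/subsetP.
pose q := #|K :\: A|; pose t := #|S|.
pose solo z y := [&& y \in B, h y z & degree_to phi U y (phi z) == 1].
case: (boolP [exists z in U, exists y, exists X,
    [&& phi z \in S, solo z y, X \in A, X != phi z & degree_to phi U z X == 0]]).
  case/exists_inP=> z zU /existsP[y /existsP[X]].
  case/and5P=> zS /and3P[yB yz /eqP y1] XA Xz /eqP zX; left.
  apply: (solo_movable yB zU yz y1 (SA _ zS) XA Xz zX).
  by have [_] := term _ zS; apply=> //; rewrite inE in XA.
move=> NM; right.
have stuck z y X : z \in U -> phi z \in S -> solo z y -> X \in A -> X != phi z ->
    0 < degree_to phi U z X.
  move=> zU zS zy XA Xz; rewrite lt0n; apply: contra NM => zX.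
  by apply/exists_inP; exists z => //; apply/existsP; exists y; apply/existsP; exists X; apply/and5P.
have KA : q + #|A| = #|K| by exact: card_KA.
have solo_degree z y : z \in U -> phi z \in S -> solo z y -> degree_in B z <= q.
  move=> zU zS zy; have := deg zU; rewrite degree_split.
  have : #|A :\ phi z| <= \sum_(c in A) degree_to phi U z c.
    rewrite (big_setD1 (phi z)) ?SA //= -sum1_card.
    apply: leq_trans (leq_addl _ _); apply: leq_sum => c /setD1P[cz cA].
    exact: stuck zy cA cz.
  by have := cardsD1 (phi z) A; rewrite SA //; alia.
(* No vertex in a class of [S] can move to an accessible class outside [S] other than [u]. So [z]
   has neighbours in at least [#|A| - t - 1] accessible classes. *)
have S_degree z : z \in U -> phi z \in S -> degree_in B z <= q + t.
  move=> zU zS; have := deg zU; rewrite degree_split.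
  have : #|A :\: S :\ u| <= \sum_(c in A) degree_to phi U z c.
    rewrite (big_setID (A :\: S :\ u)) /= -sum1_card.
    rewrite (setIidPr _); last first.
      by apply/subsetP => c /setD1P[_ /setDP[]].
    apply: leq_trans (leq_addr _ _); apply: leq_sum => c /setD1P[cu /setDP[cA cS]].
    rewrite lt0n; have cA' : connect (movable phi U) c a by rewrite inE in cA.
    apply: contra (edge _ _ zS cA' cS cu) => zc.
    by apply/exists_inP; exists z; rewrite ?eqxx.
  have := cardsD1 u (A :\: S); have := cardsID S A; rewrite (setIidPr sSA) -/t.
  by have := leq_b1 (u \in A :\: S); alia.
have S_size W : W \in S -> class_size phi U W = s.
  move=> WS; have := class_size_A (SA _ WS).
  by case: eqP WS => [->|_ _]; [rewrite (negPf aS) | rewrite addn0].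
have BU x : x \in B -> x \in U /\ phi x \notin A by rewrite [in x \in B]inE => /andP[].
have lt_qt : q < t.
  have [W WS] := set0Pn _ S0; rewrite ltnNge; apply/negP => tq.
  (* Give solo vertices weight 2: each vertex of B then sees weight at least 2
     in W, and a vertex of W distributes at most 2 q. *)
  pose w z := if [exists y, solo z y] then 2 else 1.
  have : #|B| * 2 <= class_size phi U W * (2 * q).
    apply: (@leq_weighted w) => [y yB|x xU xW]; last first.
      rewrite /w; case: existsP => [[y xy]|_].
        by rewrite leq_mul2l (solo_degree x y) ?xW.
      by rewrite mul1n; have := S_degree _ xU; rewrite xW => /(_ WS); alia.
    have := B_degree_to yB (SA _ WS); rewrite leq_eqVlt => /orP[/eqP y1|].
      have /degree_to_gt0[z zU /andP[yz zW]] : 0 < degree_to phi U y W by rewrite -y1.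
      rewrite (bigD1 z) //= yz zW mul1n; apply: leq_trans (leq_addr _ _).
      rewrite /w; case: existsP => // [[]]; exists y.
      by rewrite /solo yB yz (eqP zW) -y1 eqxx.
    move/leq_trans; apply; apply: leq_sum => z _.
    by rewrite /w leq_pmulr //; case: ifP.
  by rewrite S_size // card_B -/q mulnDl mulnC [q * s]mulnC; nia.
pose sigma y := \sum_(c in S) (degree_to phi U y c == 1).
(* A vertex of [B] has at least one neighbour in each accessible class, and at least two in each
   class of [S] that [sigma y] does not count. *)
have sigma_lb y : y \in B -> t + degree_in B y + 1 <= q + sigma y.
  move=> yB; have yU : y \in U by case: (BU _ yB).
  have := deg yU; rewrite degree_split.
  have : #|A| + t <= \sum_(c in A) degree_to phi U y c + sigma y.
    rewrite /t -!sum1_card (big_setID S) /= (setIidPr sSA).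
    rewrite [X in _ <= X + _](big_setID S) /= (setIidPr sSA) /sigma.
    rewrite addnAC -big_split addnAC -big_split /=.
    apply: leq_add; apply: leq_sum => c; last first.
      by move=> /setDP[cA _]; apply: B_degree_to.
    by move=> /SA/(B_degree_to yB); case: degree_to => [|[|]].
  alia.
have sigmaE y : sigma y = \sum_(z in [set z in U | phi z \in S])
    (h y z && (degree_to phi U y (phi z) == 1)).
  rewrite /sigma (partition_big phi (mem S)) /=; last by move=> z; rewrite inE => /andP[].
  apply: eq_bigr => c cS.
  transitivity ((degree_to phi U y c == 1) * degree_to phi U y c).
    by case: eqP => [->|]; rewrite ?mul0n.
  rewrite /degree_to big_distrr /= [RHS]big_mkcond [LHS]big_mkcond /=.
  apply: eq_bigr => z _; rewrite inE; case: (z \in U) => //=.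
  case: (eqVneq (phi z) c) => [->|]; last by rewrite andbF andbF muln0.
  by rewrite cS andbT; case: (h y z); rewrite ?muln0 ?muln1.
(* A maximal independent set [I] dominates [B], so the closed degrees of its vertices sum to at
   least [#|B|]. *)
pose indep (I : {set V}) := (I \subset B) && [forall x in I, forall y in I, ~~ h x y].
have indep0 : indep set0.
  by rewrite /indep sub0set; apply/forall_inP => x; rewrite inE.
have [I /maxsetP[/andP[IB II] Imax] _] := maxset_exists indep0.
have II' x y : x \in I -> y \in I -> ~~ h x y.
  by move=> xI yI; move/forall_inP/(_ _ xI)/forall_inP/(_ _ yI): II.
have cover_B : #|B| <= \sum_(x in I) (degree_in B x + 1).
  have -> : \sum_(x in I) (degree_in B x + 1) = \sum_(y in B) \sum_(x in I) (h x y + (x == y)).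
    rewrite [RHS]exchange_big; apply: eq_bigr => x xI /=; rewrite big_split /=.
    congr (_ + _); rewrite (bigD1 x) ?(subsetP IB) //= eqxx big1 // => y /andP[_].
    by rewrite eq_sym => /negPf->.
  rewrite -sum1_card; apply: leq_sum => y yB.
  case: (boolP (y \in I)) => yI.
    by rewrite (bigD1 y) //= eqxx addn1.
  case: (boolP [exists x in I, h x y]) => [/exists_inP[x xI xy]|].
    by rewrite (bigD1 x) //= xy.
  rewrite negb_exists_in => /forall_inP ny; exfalso.
  suff E : y |: I = I by rewrite -E setU11 in yI.
  apply: Imax; last exact: subsetUr.
  rewrite /indep subUset sub1set yB IB /=.
  apply/forall_inP => x /setU1P[->|xI]; apply/forall_inP => x' /setU1P[->|x'I].
  - by rewrite hirr.
  - by rewrite hsym ny.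
  - exact: ny.
  - exact: II'.
have I_gt : s < #|I|.
  have : #|B| <= #|I| * q.
    apply: leq_trans cover_B _; rewrite -sum_nat_const; apply: leq_sum => x xI.
    by have := B_degree (subsetP IB _ xI); alia.
  by rewrite card_B -/q [_ * q]mulnC addn1 ltn_mul2l => /andP[].
(* By [sigma_lb] the sum is at least [(t - q) * #|I| + #|B|], which exceeds [(t - q) * s + q * s].
   As [t * s] is the number of vertices in the classes of [S], two vertices of [I] must share a
   unique neighbour. *)
have sum_sigma : t * s < \sum_(x in I) sigma x.
  have : \sum_(x in I) (t + (degree_in B x + 1)) <= \sum_(x in I) (q + sigma x).
    by apply: leq_sum => x xI; rewrite addnA sigma_lb // (subsetP IB).
  rewrite !big_split /= => c2.
  have := cover_B; rewrite card_B -/q big_split /= => c1; move: c2.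
  rewrite !sum_nat_const => c2.
  have : (t - q) * s <= (t - q) * #|I| by rewrite leq_mul2l ltnW ?orbT.
  rewrite !mulnBl; have : q * s <= t * s by rewrite leq_mul2r ltnW ?orbT.
  have : q * #|I| <= t * #|I| by rewrite leq_mul2r ltnW ?orbT.
  by move: c1 c2; rewrite !sum_nat_const; alia.
have US : #|[set z in U | phi z \in S]| = t * s.
  by rewrite -class_size_sum -sum_nat_const; apply: eq_bigr => c /S_size.
have [z zUS /card_gt1P[y1 [y2 []]]] : exists2 z, z \in [set z in U | phi z \in S] &
    1 < #|[set x in I | h x z && (degree_to phi U x (phi z) == 1)]|.
  apply/exists_inP; rewrite -[X in is_true X]negbK negb_exists_in; apply/negP => /forall_inP H.
  move: sum_sigma; rewrite ltnNge => /negP[]; rewrite (eq_bigr _ (fun x _ => sigmaE x)).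
  rewrite exchange_big -US -sum1_card; apply: leq_sum => z /H.
  by rewrite -leqNgt card_set_sum.
rewrite !inE => /and3P[y1I y1z /eqP d1] /and3P[y2I y2z /eqP d2] y12.
move: zUS; rewrite inE => /andP[zU zS].
have [y1B y2B] := (subsetP IB _ y1I, subsetP IB _ y2I).
apply: (solo_swap y1B y2B y12 (II' _ _ y1I y2I) zU (SA _ zS) _ y1z y2z d1 d2).
  by apply: contraNneq aS => <-.
move=> X XA Xz; split; first by apply: (stuck z y1 X zU zS _ XA Xz); rewrite /solo y1B y1z d1.
by have [_] := term _ zS; apply=> //; rewrite inE in XA.
Qed.

End Near.

Lemma equitable_of_nearly phi a b :
  nearly_equitable phi U K s a b -> exists psi, equitable psi U K s.
Proof.
have [m] := ubnP (#|C| - #|[set c | connect (movable phi U) c a]|).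
elim: m phi b => // m IHm phi b lt near.
case: (boolP (b \in [set c | connect (movable phi U) c a])).
  exact: accessible_large near.
case/(nearly_equitable_step near) => [//|[psi [c [near' gt]]]].
apply: IHm near'; apply: leq_trans (ltn_sub2l _ gt) _ => //.
exact: leq_trans gt (max_card _).
Qed.

End Step.
End Colouring.

Lemma degree_in_sub (V : finType) (h h' : rel V) (U : {set V}) x :
  (forall y, h x y -> h' x y) -> degree_in h U x <= degree_in h' U x.
Proof. by move=> H; apply: leq_sum => y _; have := H y; case: (h x y) => // ->. Qed.

Theorem hajnal_szemeredi (V C : finType) (c0 : C) (h : rel V) (U : {set V})
    (K : {set C}) (s : nat) :
    symmetric h -> irreflexive h -> #|U| = #|K| * s ->
    (forall x, x \in U -> degree_in h U x < #|K|) ->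
  exists phi : V -> C, equitable h phi U K s.
Proof.
have [k] := ubnP #|K|; elim: k h U K => // k IHk h U K; rewrite ltnS => leK.
move=> hsym hirr cU deg.
(* Insert the edges of h one vertex at a time. *)
pose hS (S : seq V) := [rel x y | [&& h x y, x \in S & y \in S]].
suff [phi [P Sz]] : exists phi, equitable (hS (enum V)) phi U K s.
  by exists phi; split=> // x y xU yU xy; apply: P => //=; rewrite xy !mem_enum.
elim: (enum V) => [|u S [phi [P Sz]]].
  have [|phi S] := @exists_fibers V C c0 U (fun c => (c \in K) * s).
    by rewrite -big_distrl /= cU; congr (_ * s); rewrite -sum1_card [RHS]big_mkcond.
  by exists phi; split=> // x y _ _; rewrite /= andbF.
have hSsym S' : symmetric (hS S') by move=> x y /=; rewrite hsym [(x \in _) && _]andbC.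
have hSirr S' : irreflexive (hS S') by move=> x /=; rewrite hirr.
have degS x : x \in U -> degree_in (hS (u :: S)) U x < #|K|.
  by move=> /deg; apply: leq_ltn_trans; apply: degree_in_sub => y /and3P[].
(* All new edges meet [u], so [phi] stays proper unless [u] has a neighbour in its own class. In
   that case [u] moves to a free class, leaving one class short and one over. *)
case: (boolP ((u \in U) && (0 < degree_to (hS (u :: S)) phi U u (phi u)))); last first.
  rewrite negb_and -leqNgt leqn0 => H; exists phi; split=> //.
  have Pu y : u \in U -> y \in U -> hS (u :: S) u y -> phi y != phi u.
    move=> uU yU uy; move: H; rewrite uU /= => /eqP/degree_to_eq0; exact.
  move=> x y xU yU xy.
  have [xu|xu] := eqVneq x u; first by rewrite eq_sym; subst x; apply: Pu.
  have [yu|yu] := eqVneq y u; first by subst y; apply: Pu => //; apply: etrans xy; apply: hSsym.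
  by apply: P => //; move: xy; rewrite /= !inE (negPf xu) (negPf yu).
case/andP=> uU dgt.
have [c cK dc] := exists_free_class phi (degS u uU).
have cu : c != phi u by apply: contraTneq dgt => <-; rewrite dc.
have uK : phi u \in K by apply: equitable_mem (conj P Sz) uU.
apply: (@equitable_of_nearly _ _ _ (hSsym _) (hSirr _) U K s degS _ (recolour phi u c) (phi u) c).
  move=> U' K' ltK cU' deg'; apply: IHk => //; exact: leq_trans ltK leK.
split=> //; last by move=> d; rewrite class_size_recolour // Sz.
apply: proper_recolour => // x y /setD1P[xu xU] /setD1P[yu yU] xy.
by apply: P => //; move: xy; rewrite /= !inE (negPf xu) (negPf yu).
Qed.

(** * Colourings without alternating 4-cycles *)

Section Rigid.
Variables (V : finType) (q : nat) (e : rel V) (f : {set V} -> 'I_q) (W : {set V}).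
Hypotheses (esym : symmetric e) (eirr : irreflexive e).
Hypothesis common_nbr : forall x y z t : V, exists2 w, w \in W &
  [&& e w x, e w y, e w z & e w t].
Local Notation g x y := (f [set x; y]).
Hypothesis rigid : forall u v a b, u \in W -> v \in W -> a \in W -> b \in W ->
  e u a -> e v a -> e u b -> e v b ->
  forall c, (g u a == c) + (g v b == c) = (g v a == c) + (g u b == c).

Let gC x y : g x y = g y x. Proof. by rewrite setUC. Qed.

(* The choice of the common neighbour is irrelevant, by rigid_eq. *)
Definition sim u v := [exists a in W, [&& e u a, e v a & g u a == g v a]].

Lemma rigid_eq u v a b : u \in W -> v \in W -> a \in W -> b \in W ->
  e u a -> e v a -> e u b -> e v b -> g u a = g v a -> g u b = g v b.
Proof.
move=> uW vW aW bW ua va ub vb E; apply/eqP.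
have := rigid uW vW aW bW ua va ub vb (g v b).
by rewrite E eqxx; case: (g v a == _); case: (g u b == _).
Qed.

(** In the equality of multisets the edge [ua] cannot be matched with [va], hence it is matched with
    [ub]. So [u] sends a single colour to all common neighbours of two vertices that are not
    similar. *)
Lemma rigid_neq u v a b : u \in W -> v \in W -> a \in W -> b \in W ->
  e u a -> e v a -> e u b -> e v b -> g u a != g v a -> g u a = g u b.
Proof.
move=> uW vW aW bW ua va ub vb E; apply/eqP.
have := rigid uW vW aW bW ua va ub vb (g u a); rewrite eqxx eq_sym [g u b == _]eq_sym.
by rewrite [g v a == _]eq_sym (negPf E); case: (g u a == g u b) => //; rewrite addnC; case: eqP.
Qed.

Lemma simE u v a : u \in W -> v \in W -> a \in W -> e u a -> e v a ->
  sim u v = (g u a == g v a).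
Proof.
move=> uW vW aW ua va; apply/exists_inP/eqP => [[b bW /and3P[ub vb /eqP E]]|E].
  exact: rigid_eq E.
by exists a; rewrite ?ua ?va ?E ?eqxx.
Qed.

Lemma sim_sym u v : sim u v = sim v u.
Proof. by apply: eq_existsb => a; rewrite eq_sym (andbCA (e u a)). Qed.

Lemma sim_trans u v w : u \in W -> v \in W -> w \in W ->
  sim u v -> sim v w -> sim u w.
Proof.
move=> uW vW wW; have [a aW] := common_nbr u v w w.
rewrite ![e a _]esym => /and4P[ua va wa _].
by rewrite (simE uW vW aW) // (simE vW wW aW) // (simE uW wW aW) // => /eqP->.
Qed.

(** Similarity along a side is read off at the opposite vertex. For the last claim, take a common
    neighbour [x] of the triangle: [uw], [ux] agree and [vw], [vx] agree, and the 4-cycle with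
    opposite vertices [u], [x] and [v], [w] forces [uv] to agree with [uw] or [vw]. *)
Lemma nsim_triangle u v w : u \in W -> v \in W -> w \in W ->
    e u v -> e u w -> e v w -> ~~ sim u v ->
  (sim v w = (g u v == g u w)) /\ (sim u w = (g u v == g v w)) /\ (sim u w || sim v w).
Proof.
move=> uW vW wW uv uw vw N.
have vu : e v u by rewrite esym.
have wu : e w u by rewrite esym.
have wv : e w v by rewrite esym.
rewrite (simE vW wW uW vu wu) [g v u]gC [g w u]gC.
rewrite (simE uW wW vW uv wv) [g w v]gC; split=> //; split=> //.
have [x xW] := common_nbr u v w w.
rewrite ![e x _]esym => /and4P[ux vx wx _].
have := N; rewrite (simE uW vW wW) // => Nw.
have E1 := rigid_neq uW vW wW xW uw vw ux vx Nw.
have E2 : g v w = g v x by apply: (rigid_neq vW uW) => //; rewrite eq_sym.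
have := rigid uW xW vW wW uv _ uw _ (g u v).
rewrite ![e x _]esym vx wx eqxx [g x w]gC [g x v]gC -E2 => /(_ isT isT).
rewrite [g u w == _]eq_sym [g v w == _]eq_sym.
by case: (g u v == g u w); case: (g u v == g v w).
Qed.

(** Whether a common neighbour is similar to [v] depends only on the colour of its edge to [u], by
    [nsim_triangle], and that colour is constant by [rigid_neq]. *)
Lemma nsim_common u v w x : u \in W -> v \in W -> w \in W -> x \in W ->
    e u v -> e u w -> e v w -> e u x -> e v x -> ~~ sim u v -> sim w v ->
  sim x v.
Proof.
move=> uW vW wW xW uv uw vw ux vx N; rewrite sim_sym [sim x v]sim_sym.
have [-> _] := nsim_triangle uW vW wW uv uw vw N.
have [-> _] := nsim_triangle uW vW xW uv ux vx N.
have := N; rewrite (simE uW vW wW) // => Nw.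
by rewrite (rigid_neq uW vW wW xW uw vw ux vx Nw).
Qed.

Lemma exists_sim_edge v : v \in W ->
  exists x y, [/\ x \in W, y \in W, e x y & sim x y].
Proof.
move=> vW; have [a aW /and4P[av _ _ _]] := common_nbr v v v v.
have [b bW /and4P[bv ba _ _]] := common_nbr v a a a.
have [s|N] := boolP (sim a v); first by exists a, v.
have [_ [_ /orP[]]] := nsim_triangle aW vW bW av (etrans (esym _ _) ba) (etrans (esym _ _) bv) N.
- by exists a, b; split=> //; rewrite esym.
- by exists v, b; split=> //; rewrite esym.
Qed.

Section Class.
Variables (v0 v1 : V).
Hypotheses (v0W : v0 \in W) (v1W : v1 \in W) (v01 : e v0 v1) (s01 : sim v0 v1).

Lemma class_edge u v : u \in W -> v \in W -> sim u v0 -> sim v v0 -> e u v ->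
  g u v = g v0 v1.
Proof.
move=> uW vW us vs uv.
(* With such an [x], the colour is carried from [uv] to [ux], then to [v0 x] and to [v0 v1], each
   time between edges that share one end and have similar other ends. *)
have [x xW [xs xu xv0]] : exists2 x, x \in W & [/\ sim x v0, e x u & e x v0].
  have [w wW /and4P[wu wv w0 _]] := common_nbr u v v0 v0.
  case: (boolP (sim w v0)) => ws; first by exists w.
  have N : ~~ sim w u.
    by apply: contra ws => wu'; apply: sim_trans wu' us.
  have [x xW /and4P[xu xw x0 _]] := common_nbr u w v0 v0; exists x => //; split=> //.
  apply: (sim_trans xW uW v0W _ us).
  apply: (nsim_common wW uW vW xW) => //; try by rewrite esym.
  by apply: (sim_trans vW v0W uW vs); rewrite sim_sym.
have vx : sim v x by apply: (sim_trans vW v0W xW vs); rewrite sim_sym.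
have x1 : sim x v1 by apply: (sim_trans xW v0W v1W).
move: vx; rewrite (simE vW xW uW) // 1?esym // => /eqP; rewrite gC => ->.
move: us; rewrite (simE uW v0W xW) // 1?esym // 1?esym // [g x u]gC => /eqP->.
by move: x1; rewrite (simE xW v1W v0W) // 1?esym // => /eqP; rewrite gC => ->; rewrite gC.
Qed.

(** Two uses of [nsim_common]. For the pair [p], [x], the common neighbour [z] is similar to [x],
    hence so is [y]. Then [y] and [p] are not similar, and their common neighbour [v0] is similar to
    [p], hence so would be [x]. *)
Lemma no_outer_edge p x z : p \in W -> x \in W -> z \in W -> sim p v0 ->
  ~~ sim x v0 -> sim x z -> e p v0 -> e p x -> e p z -> e x z -> False.
Proof.
move=> pW xW zW ps xs xz p0 px pz exz.
have Npx : ~~ sim p x.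
  by apply: contra xs => spx; apply: sim_trans ps; rewrite // sim_sym.
have [y yW /and4P[yp yx y0 _]] := common_nbr p x v0 v0.
have syx : sim y x.
  by apply: (nsim_common pW xW zW yW) => //; rewrite 1?sim_sym // esym.
have Nyp : ~~ sim y p.
  by apply: contra Npx => syp; apply: (sim_trans pW yW xW); rewrite // sim_sym.
case/negP: Npx; rewrite sim_sym; apply: (nsim_common yW pW v0W xW) => //.
by rewrite sim_sym.
Qed.

(** Complete the edge [xy] to a triangle by a common neighbour [z] that also sees [v0] and [v1];
    this is where four vertices need one. If [z] is similar to [v0], the triangle contradicts
    [no_outer_edge]; otherwise a common neighbour [p] of [z], [v0], [x] takes the role of [z] and
    [z] that of [y]. *)
Lemma outside_independent x y : x \in W -> y \in W ->
  ~~ sim x v0 -> ~~ sim y v0 -> ~~ e x y.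
Proof.
move=> xW yW xs ys; apply/negP => xy.
have [z zW /and4P[zx zy z0 z1]] := common_nbr x y v0 v1.
case: (boolP (sim z v0)) => zs.
  have Nzx : ~~ sim z x by apply: contra xs => szx; apply: (sim_trans xW zW); rewrite // sim_sym.
  have Nzy : ~~ sim z y by apply: contra ys => szy; apply: (sim_trans yW zW); rewrite // sim_sym.
  have [_ [_]] := nsim_triangle zW xW yW zx zy xy Nzx.
  by rewrite (negPf Nzy) /= => sxy; apply: (@no_outer_edge z x y).
have [p pW /and4P[pz p0 px _]] := common_nbr z v0 x x.
have ps : sim p v0.
  apply: (nsim_common zW v0W v1W pW) => //; try by rewrite esym.
  by rewrite sim_sym.
have Npx : ~~ sim p x by apply: contra xs => s; apply: (sim_trans xW pW); rewrite // sim_sym.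
have Npz : ~~ sim p z by apply: contra zs => s; apply: (sim_trans zW pW); rewrite // sim_sym.
have xz : e x z by rewrite esym.
have [_ [_]] := nsim_triangle pW xW zW px pz xz Npx.
by rewrite (negPf Npz) /= => sxz; apply: (@no_outer_edge p x z).
Qed.

End Class.

Lemma rigid_structure : exists (b : 'I_q) (S : {set V}),
  [/\ S \subset W, {in S &, forall x y, ~~ e x y} &
      {in W &, forall x y, e x y -> g x y != b -> (x \in S) || (y \in S)}].
Proof.
(* For empty [W] any colour will do; [f set0] merely provides one. *)
have [->|[v vW]] := set_0Vmem W.
  by exists (f set0), set0; split=> [|x|x]; rewrite ?sub0set ?inE.
have [v0 [v1 [v0W v1W v01 s01]]] := exists_sim_edge vW.
exists (g v0 v1), [set x in W | ~~ sim x v0]; split.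
- by apply/subsetP => x; rewrite inE => /andP[].
- move=> x y; rewrite !inE => /andP[xW xs] /andP[yW ys].
  exact: (outside_independent v0W v1W v01 s01).
move=> x y xW yW xy; apply: contraR; rewrite !inE xW yW negb_or !negbK.
by move=> /andP[xs ys]; apply/eqP/(class_edge v0W v1W v01 s01).
Qed.

End Rigid.

(** * Tilings and gadgets *)

Lemma set2_card (T : finType) (E : {set T}) : #|E| = 2 ->
  exists x y, [/\ x != y & E = [set x; y]].
Proof. by move/eqP/cards2P => [x [y [xy ->]]]; exists x, y. Qed.

Lemma sum_card_fibers (T C : finType) (A : {set T}) (g : T -> C) :
  \sum_c #|[set x in A | g x == c]| = #|A|.
Proof.
under eq_bigr do rewrite card_set_sum.
rewrite exchange_big -sum1_card; apply: eq_bigr => x _ /=.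
by rewrite (bigD1 (g x)) //= eqxx big1 // => c; rewrite eq_sym => /negPf->.
Qed.

Section Counts.
Variables (V C : finType) (f : {set V} -> C).

Definition pairs (B : {set V}) := [set E : {set V} | (E \subset B) && (#|E| == 2)].
Definition colour_count (B : {set V}) c := #|[set E in pairs B | f E == c]|.
Definition tiling_count (P : {set {set V}}) c := \sum_(B in P) colour_count B c.

Lemma card_pairs B : #|pairs B| = 'C(#|B|, 2).
Proof. by rewrite -cards_draws. Qed.

Lemma sum_colour_count B : \sum_c colour_count B c = 'C(#|B|, 2).
Proof. by rewrite sum_card_fibers card_pairs. Qed.

Lemma leq_colour_count (A B : {set V}) c : A \subset B -> colour_count A c <= colour_count B c.
Proof.
move=> AB; apply: subset_leq_card; apply/subsetP => E; rewrite !inE.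
by case/andP=> /andP[EA ->] ->; rewrite (subset_trans EA AB).
Qed.

Lemma colour_count_mono (B : {set V}) c : {in B &, forall x y, x != y -> f [set x; y] = c} ->
  colour_count B c = 'C(#|B|, 2).
Proof.
move=> H; rewrite -card_pairs; apply: eq_card => E; rewrite inE.
case: (boolP (E \in pairs B)) => //=; rewrite inE => /andP[EB /eqP/set2_card[x [y [xy EE]]]].
by rewrite EE H ?eqxx //; apply: (subsetP EB); rewrite EE !inE eqxx ?orbT.
Qed.

Lemma colour_countU1 u (A : {set V}) c : u \notin A ->
  colour_count (u |: A) c = colour_count A c + \sum_(x in A) (f [set u; x] == c).
Proof.
move=> uA; rewrite -card_set_sum.
rewrite /colour_count -(cardsID [set E : {set V} | u \notin E]); congr (_ + _).
  apply: eq_card => E; rewrite !inE -!andbA; case: (f E == c); rewrite ?andbF //=.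
  case: (#|E| == 2); rewrite ?andbF //= !andbT.
  apply/andP/idP => [[/subsetP EA uE]|EA].
    apply/subsetP => x xE; case/setU1P: (EA x xE) => // xu.
    by rewrite -xu xE in uE.
  split; first by apply: subset_trans EA (subsetUr _ _).
  by apply: contra uA; apply: (subsetP EA).
rewrite -(card_in_imset (f := fun x => [set u; x])); last first.
  move=> x y; rewrite !inE => /andP[xA _] /andP[yA _] /setP/(_ x).
  rewrite !inE eqxx orbT => /esym/orP[/eqP xu|/eqP//].
  by rewrite -xu xA in uA.
apply: eq_card => E; apply/idP/imsetP => [|[x]].
  rewrite !inE negbK => /and3P[uE /andP[EA /eqP/set2_card[x [y [xy EE]]]] fE].
  have [z zE zu] : exists2 z, E = [set u; z] & z != u.
    move: uE; rewrite EE !inE => /orP[/eqP ux|/eqP uy].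
      by exists y; rewrite ux // eq_sym.
    by exists x; rewrite uy // setUC.
  exists z; rewrite // inE -zE fE andbT.
  have : z \in u |: A by apply: (subsetP EA); rewrite zE !inE eqxx orbT.
  by rewrite !inE (negPf zu).
rewrite inE => /andP[xA fx] ->; rewrite !inE eqxx fx /= cards2 andbT.
rewrite subUset !sub1set !inE eqxx xA orbT /=.
by rewrite (_ : u != x) //; apply: contraNneq uA => ->.
Qed.

Lemma edges_tiling (P : {set {set V}}) D : finset.partition P D ->
  forall c, #|[set E in edges (tiling_graph P) | f E == c]| = tiling_count P c.
Proof.
move=> /and3P[_ /trivIsetP tP _] c.
have edgeE E : (E \in edges (tiling_graph P)) = [exists B in P, E \in pairs B].
  apply/imset2P/exists_inP => [[x y _]|[B BP]].
    rewrite inE /= => /andP[_ /andP[xy /exists_inP[B BP /andP[xB yB]]]] ->.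
    by exists B; rewrite // inE subUset !sub1set xB yB cards2 xy.
  rewrite inE => /andP[EB /eqP/set2_card[x [y [xy EE]]]].
  exists x y => //; rewrite inE in_setT /tiling_graph /= xy; apply/exists_inP; exists B => //.
  by rewrite -!sub1set -subUset -EE.
have -> : #|[set E in edges (tiling_graph P) | f E == c]| =
    \sum_E ((E \in edges (tiling_graph P)) && (f E == c)).
  rewrite -sum1_card big_mkcond; apply: eq_bigr => E _; rewrite inE; by case: ifP.
rewrite /tiling_count.
under [RHS]eq_bigr => B BP.
  rewrite /colour_count -sum1_card big_mkcond.
  under eq_bigr => E do rewrite inE.
  over.
rewrite exchange_big; apply: eq_bigr => E _ /=; rewrite edgeE.
case: (boolP (f E == c)) => fE; last by rewrite andbF big1 // => B _; rewrite andbF.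
rewrite andbT; case: exists_inP => [[B BP EB]|N].
  rewrite (bigD1 B) //= EB big1 ?addn0 // => B' /andP[B'P BB'].
  case: ifP => // /andP[EB' _]; have := tP _ _ B'P BP BB'.
  move: EB EB'; rewrite !inE => /andP[EB /eqP E2] /andP[EB' _].
  move/disjoint_setI0 => I0.
  have : E \subset B' :&: B by rewrite subsetI EB' EB.
  by rewrite I0 subset0 => /eqP E0; rewrite E0 cards0 in E2.
by rewrite big1 // => B BP; case: ifP => // /andP[EB _]; case: N; exists B.
Qed.

End Counts.

Section Tilings.
Variables (V : finType) (q r : nat) (e : rel V) (f : {set V} -> 'I_q).
Hypotheses (esym : symmetric e) (eirr : irreflexive e).
Implicit Types (Z B : {set V}) (P : {set {set V}}).
Local Notation tcount := (tiling_count f).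

(** The relative form of [is_Kr_tiling], to which it is convertible when [Z] is [[set: V]]; gadgets
    and their complement are tiled separately. *)
Definition tiling Z P := finset.partition P Z && [forall B in P, is_Kr_copy e r B].

Lemma tilingP Z P : reflect (finset.partition P Z /\ forall B, B \in P ->
    #|B| = r /\ {in B &, forall x y, x != y -> e x y}) (tiling Z P).
Proof.
apply: (iffP andP) => -[pP H]; split=> //.
  move=> B /(forall_inP H)/andP[/eqP cB /forall_inP eB]; split=> // x y xB yB.
  by move/forall_inP: (eB x xB) => /(_ y yB)/implyP.
apply/forall_inP => B /H[cB eB]; rewrite /is_Kr_copy cB eqxx /=.
by apply/forall_inP => x xB; apply/forall_inP => y yB; apply/implyP/eB.
Qed.

Lemma tiling_card Z P : tiling Z P -> #|P| * r = #|Z|.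
Proof.
case/tilingP=> pP H; symmetry; apply: card_uniform_partition pP.
by move=> B /H[].
Qed.

Lemma tiling_edges Z P : tiling Z P -> \sum_c tcount P c = #|P| * 'C(r, 2).
Proof.
case/tilingP=> _ H; rewrite exchange_big /= -sum_nat_const; apply: eq_bigr => B /H[cB _].
by rewrite sum_colour_count cB.
Qed.

Lemma tiling0 : tiling set0 set0.
Proof.
apply/tilingP; split=> [|B]; last by rewrite inE.
rewrite /finset.partition /cover big_set0 eqxx inE andbT.
by apply/trivIsetP => B B'; rewrite inE.
Qed.

Lemma tiling1 B : 0 < r -> #|B| = r -> {in B &, forall x y, x != y -> e x y} ->
  tiling B [set B].
Proof.
move=> r0 cB eB; apply/tilingP; split=> [|_ /set1P->//].
rewrite /finset.partition /cover big_set1 eqxx /= inE eq_sym -cards_eq0 cB.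
rewrite -lt0n r0 andbT; apply/trivIsetP => A A' /set1P-> /set1P->.
by rewrite eqxx.
Qed.

Lemma tilingU Z1 Z2 P1 P2 : [disjoint Z1 & Z2] -> tiling Z1 P1 -> tiling Z2 P2 ->
  tiling (Z1 :|: Z2) (P1 :|: P2) /\
  forall c, tcount (P1 :|: P2) c = tcount P1 c + tcount P2 c.
Proof.
move=> D /tilingP[p1 H1] /tilingP[p2 H2].
have sub1 B : B \in P1 -> B \subset Z1 by apply: partitionS.
have sub2 B : B \in P2 -> B \subset Z2 by apply: partitionS.
have dis B B' : B \in P1 -> B' \in P2 -> [disjoint B & B'].
  by move=> /sub1 S1 /sub2 S2; apply: disjointWl S1 (disjointWr S2 D).
have [/and3P[/eqP c1 /trivIsetP t1 n1] /and3P[/eqP c2 /trivIsetP t2 n2]] := (p1, p2).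
split.
  apply/tilingP; split=> [|B /setUP[]]; [|exact: H1|exact: H2].
  apply/and3P; split; last by rewrite inE negb_or n1.
    by rewrite /cover bigcup_setU -c1 -c2.
  apply/trivIsetP => A B /setUP[] AP /setUP[] BP AB.
  - exact: t1.
  - exact: dis.
  - by rewrite disjoint_sym dis.
  - exact: t2.
move=> c; rewrite /tiling_count -bigU /=; first by apply: eq_bigl => B; rewrite !inE.
rewrite disjoint_subset; apply/subsetP => B B1; rewrite inE; apply/negP => B2.
have := dis _ _ B1 B2; rewrite -setI_eq0 setIid => /eqP B0.
by rewrite B0 (negPf n1) in B1.
Qed.

Lemma tiling_family (Gs : {set {set V}}) c (w : {set V} -> nat) : trivIset Gs ->
    (forall Z, Z \in Gs -> exists P1 P2,
      [/\ tiling Z P1, tiling Z P2 & tcount P1 c + w Z <= tcount P2 c]) ->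
  exists P1 P2, [/\ tiling (cover Gs) P1, tiling (cover Gs) P2 &
    tcount P1 c + \sum_(Z in Gs) w Z <= tcount P2 c].
Proof.
elim: {Gs}#|Gs| {-2}Gs (erefl #|Gs|) => [|k IH] Gs.
  move/eqP; rewrite cards_eq0 => /eqP-> _ _; exists set0, set0.
  by rewrite /cover big_set0 tiling0 /tiling_count !big_set0.
move=> cG tG H; have [Z ZG] : exists Z, Z \in Gs by apply/card_gt0P; rewrite cG.
have [||Z'|P1 [P2 [t1 t2 le12]]] := IH (Gs :\ Z).
- by have := cardsD1 Z Gs; rewrite ZG cG => -[].
- by apply: trivIsetS tG; apply: subsetDl.
- by case/setD1P=> _; apply: H.
have [Q1 [Q2 [s1 s2 le]]] := H Z ZG.
have cE : cover Gs = Z :|: cover (Gs :\ Z) by rewrite /cover (big_setD1 Z).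
have D : [disjoint Z & cover (Gs :\ Z)].
  apply: bigcup_disjoint => Z' /setD1P[ZZ' Z'G].
  by move/trivIsetP: tG => /(_ _ _ Z'G ZG ZZ'); rewrite disjoint_sym.
have [u1 e1] := tilingU D s1 t1; have [u2 e2] := tilingU D s2 t2.
exists (Q1 :|: P1), (Q2 :|: P2); rewrite cE; split=> //.
by rewrite e1 e2 (big_setD1 Z) //= addnACA leq_add.
Qed.


Definition gadget Z := (#|Z| == 2 * r) && [exists P1, exists P2,
  [&& tiling Z P1, tiling Z P2 & [exists c, tcount P1 c < tcount P2 c]]].

Lemma no_gadget Z P1 P2 c : ~~ gadget Z -> #|Z| = 2 * r ->
  tiling Z P1 -> tiling Z P2 -> tcount P1 c = tcount P2 c.
Proof.
move=> N cZ t1 t2; have H Q1 Q2 : tiling Z Q1 -> tiling Z Q2 -> tcount Q2 c <= tcount Q1 c.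
  move=> s1 s2; rewrite leqNgt; apply: contra N => lt; rewrite /gadget cZ eqxx.
  apply/existsP; exists Q1; apply/existsP; exists Q2; rewrite s1 s2 /=.
  by apply/existsP; exists c.
by apply/eqP; rewrite eqn_leq !H.
Qed.

Definition clique (A : {set V}) := {in A &, forall x y, x != y -> e x y}.

Lemma cliqueU1 u (A : {set V}) : clique A -> {in A, forall x, e u x} -> clique (u |: A).
Proof.
move=> cA uA x y /setU1P[->|xA] /setU1P[->|yA] xy.
- by rewrite eqxx in xy.
- exact: uA.
- by rewrite esym uA.
- exact: cA.
Qed.

Lemma nbr_notin u (A : {set V}) : {in A, forall x, e u x} -> u \notin A.
Proof. by move=> H; apply/negP => /H; rewrite eirr. Qed.

(** The cliques [u |: A], [v |: B] and the cliques [v |: A], [u |: B] tile the same 2r vertices. The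
    edges inside [A] and [B] cancel from the equality of the counts. *)
Lemma exchange u v (A B : {set V}) : 0 < r -> u != v ->
    clique A -> clique B -> #|A| = r.-1 -> #|B| = r.-1 -> [disjoint A & B] ->
    {in A :|: B, forall x, e u x} -> {in A :|: B, forall x, e v x} ->
    ~~ gadget (u |: (v |: (A :|: B))) ->
  forall c, \sum_(x in A) (f [set u; x] == c) + \sum_(x in B) (f [set v; x] == c) =
            \sum_(x in A) (f [set v; x] == c) + \sum_(x in B) (f [set u; x] == c).
Proof.
move=> r0 uv cA cB nA nB D uAB vAB N c.
have uA : {in A, forall x, e u x} by move=> x xA; apply: uAB; rewrite inE xA.
have uB : {in B, forall x, e u x} by move=> x xB; apply: uAB; rewrite inE xB orbT.
have vA : {in A, forall x, e v x} by move=> x xA; apply: vAB; rewrite inE xA.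
have vB : {in B, forall x, e v x} by move=> x xB; apply: vAB; rewrite inE xB orbT.
have card w (A' : {set V}) : {in A', forall x, e w x} -> #|A'| = r.-1 -> #|w |: A'| = r.
  by move=> /nbr_notin wA c'; rewrite cardsU1 wA c' add1n prednK.
have til w w' : w != w' -> {in A, forall x, e w x} -> {in B, forall x, e w' x} ->
    {in B, forall x, e w x} -> {in A, forall x, e w' x} ->
    tiling ((w |: A) :|: (w' |: B)) ([set w |: A] :|: [set w' |: B]) /\
    tcount ([set w |: A] :|: [set w' |: B]) c =
      colour_count f A c + \sum_(x in A) (f [set w; x] == c) +
      (colour_count f B c + \sum_(x in B) (f [set w'; x] == c)).
  move=> ww wA wB wB' wA'.
  have D' : [disjoint w |: A & w' |: B].
    rewrite -setI_eq0; apply/eqP/setP => x; rewrite !inE.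
    apply/negP => /andP[/orP[/eqP->|xA] /orP[/eqP E|xB]].
    - by rewrite E eqxx in ww.
    - by have := wB' _ xB; rewrite eirr.
    - by rewrite E in xA; have := wA' _ xA; rewrite eirr.
    - by rewrite (disjointFr D xA) in xB.
  have [t] := tilingU D' (tiling1 r0 (card _ _ wA nA) (cliqueU1 cA wA))
                         (tiling1 r0 (card _ _ wB nB) (cliqueU1 cB wB)).
  move=> /(_ c) E; split=> //; rewrite E /tiling_count !big_set1.
  by rewrite !colour_countU1 //; apply: nbr_notin.
have [t1 E1] := til u v uv uA vB uB vA.
have vu : v != u by rewrite eq_sym.
have [t2 E2] := til v u vu vA uB vB uA.
have ZE w w' : (w |: A) :|: (w' |: B) = w |: (w' |: (A :|: B)).
  by rewrite -!setUA; congr (_ :|: _); rewrite setUCA.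
rewrite ZE in t1; rewrite ZE setUCA in t2.
have cZ : #|u |: (v |: (A :|: B))| = 2 * r.
  rewrite !cardsU1 (nbr_notin vAB) inE in_set1 (negPf uv) (nbr_notin uAB).
  rewrite cardsU nA nB; move: D; rewrite -setI_eq0 => /eqP->; rewrite cards0.
  by move: r0; alia.
by have := no_gadget c N cZ t1 t2; rewrite E1 E2; alia.
Qed.

(** Hajnal-Szemeredi for the complement graph with [#|Z| %/ r] colours. A vertex is among its own
    non-neighbours, which turns the weak inequality into the strict degree bound. *)
Lemma exists_tiling Z : 0 < r -> r %| #|Z| ->
    (forall x, r * #|[set y | ~~ e x y]| <= #|Z|) -> exists P, tiling Z P.
Proof.
move=> r0 rZ deg.
have [->|[z0 z0Z]] := set_0Vmem Z; first by exists set0; apply: tiling0.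
pose k := #|Z| %/ r; have kr : k * r = #|Z| by rewrite divnK.
have k0 : 0 < k.
  by rewrite divn_gt0 // dvdn_leq //; apply/card_gt0P; exists z0.
pose h x y := (x != y) && ~~ e x y.
have hsym : symmetric h by move=> x y; rewrite /h eq_sym esym.
have hirr : irreflexive h by move=> x; rewrite /h eqxx.
have [||phi [P S]] := @hajnal_szemeredi V 'I_k (Ordinal k0) h Z setT r hsym hirr.
- by rewrite cardsT card_ord kr.
- move=> x xZ; rewrite cardsT card_ord.
  rewrite /degree_in -card_set_sum.
  have := deg x; rewrite -kr mulnC leq_pmul2r // (cardsD1 x) inE eirr /= add1n.
  apply: leq_trans; rewrite ltnS; apply: subset_leq_card; apply/subsetP => y.
  by rewrite !inE /h eq_sym => /and3P[_ -> ->].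
exists (preim_partition phi Z); apply/tilingP; split; first exact: preim_partitionP.
have fib B : B \in preim_partition phi Z -> exists2 x, x \in Z & B = [set y in Z | phi x == phi y].
  by case/imsetP=> x xZ ->; exists x.
move=> B /fib[x xZ ->]; split.
  have := S (phi x); rewrite in_setT mul1n => <-.
  by rewrite card_set_sum; apply: eq_bigr => y _; rewrite eq_sym.
move=> y z; rewrite !inE => /andP[yZ /eqP xy] /andP[zZ /eqP xz] yz.
have := P y z yZ zZ; rewrite /h yz /= -xy -xz eqxx; case: (e y z) => // H.
by have := H isT.
Qed.

(** * Cliques and 4-cycles under a degree condition *)

Section Degree.
Variable M : nat.
Hypothesis nondeg : forall x, #|[set y | ~~ e x y]| <= M.

Lemma common_nbr_avoiding (X F : {set V}) : #|X| * M + #|F| < #|V| ->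
  exists2 w, w \notin F & {in X, forall x, e x w}.
Proof.
move=> lt; case: (boolP [exists w, (w \notin F) && [forall x in X, e x w]]).
  by case/existsP=> w /andP[wF /forall_inP H]; exists w.
rewrite negb_exists => /forallP N; move: lt; rewrite ltnNge => /negP[].
have -> : #|F| = \sum_w (w \in F) by rewrite -sum1_card big_mkcond; apply: eq_bigr => w _; case: (w \in F).
apply: (@leq_trans (\sum_w (\sum_(x in X) ~~ e x w + (w \in F)))).
  rewrite -sum1_card; apply: leq_sum => w _; have := N w.
  rewrite negb_and negbK; case: (w \in F) => /=; first by rewrite addn1.
  rewrite negb_forall_in => /exists_inP[x xX xw].
  by rewrite (bigD1 x) //= xw.
rewrite big_split leq_add2r exchange_big /= -sum_nat_const; apply: leq_sum => x _.
apply: leq_trans (nondeg x); rewrite -sum1_card [X in _ <= X]big_mkcond /=.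
by apply: leq_sum => w _; rewrite inE; case: (e x w).
Qed.

(** Greedy choice: the last vertex must see at most [#|X| + k - 1] others. The missing [M] stands on
    the right to avoid subtraction. *)
Lemma exists_clique k (X F : {set V}) : (#|X| + k) * M + #|F| < #|V| + M ->
  exists K : {set V}, [/\ #|K| = k, clique K, [disjoint K & F] &
    {in X & K, forall x y, e x y}].
Proof.
elim: k X => [|k IH] X lt.
  exists set0; split; rewrite ?cards0 ?disjoints0 //; first by move=> x y; rewrite inE.
    by rewrite -setI_eq0 set0I.
  by move=> x y _; rewrite inE.
have [|w wF wX] := @common_nbr_avoiding X F.
  move: lt; rewrite addnS mulSn mulnDl; alia.
have [|K [cK qK DK XK]] := IH (w |: X).
  apply: leq_ltn_trans lt; rewrite leq_add2r leq_mul2r.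
  by rewrite cardsU1; case: (w \in X); rewrite /= ?add1n ?add0n ?addSn ?addnS ?leqnn ?orbT // leqnSn orbT.
have wK : {in K, forall y, e w y} by move=> y yK; apply: XK; rewrite // setU11.
exists (w |: K); split.
- by rewrite cardsU1 (nbr_notin wK) cK.
- exact: cliqueU1.
- rewrite disjoint_subset; apply/subsetP => y /setU1P[->|yK]; first by rewrite inE.
  by rewrite inE (disjointFr DK).
- move=> x y xX /setU1P[->|yK]; first exact: wX.
  by apply: XK => //; rewrite setU1r.
Qed.

(** Let [K] be a clique of r - 2 common neighbours of the four vertices and [B] a clique of r - 1
    common neighbours of [u] and [v]. Subtracting [exchange] for [b |: K] from [exchange] for
    [a |: K] cancels all terms from [K] and [B]. The last vertex of [K] must see 4 + (r - 3) = r + 1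
    vertices, and the summand [r] pays for avoiding [a], [b] and [K] when choosing [B]. *)
Lemma rigid_of_no_gadget (F : {set V}) : 3 <= r ->
    r.+1 * M + #|F| + r < #|V| ->
    (forall Z, [disjoint Z & F] -> ~~ gadget Z) ->
  forall u v a b, u \notin F -> v \notin F -> a \notin F -> b \notin F ->
  e u a -> e v a -> e u b -> e v b ->
  forall c, (f [set u; a] == c) + (f [set v; b] == c) =
            (f [set v; a] == c) + (f [set u; b] == c).
Proof.
move=> r3 lt N u v a b uF vF aF bF ua va ub vb c.
have [->|uv] := eqVneq u v; first by [].
have [->|ab] := eqVneq a b; first by rewrite addnC.
have r0 : 0 < r by apply: leq_trans r3.
pose X := [set u; v; a; b].
have cX : #|X| <= 4.
  by rewrite /X -!setUA !cardsU1 cards1; do 3!case: (_ \notin _).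
have [|K [cK qK DK XK]] := @exists_clique (r - 2) X F.
  apply: (@leq_ltn_trans ((4 + (r - 2)) * M + #|F|)).
    by rewrite leq_add2r leq_mul2r leq_add2r cX orbT.
  have -> : 4 + (r - 2) = r.+2 by move: r3; alia.
  by rewrite mulSn; move: lt; alia.
have inX : [/\ u \in X, v \in X, a \in X & b \in X] by rewrite !inE !eqxx !orbT.
have [uX vX aX bX] := inX.
have aK : {in K, forall x, e a x} by move=> x; apply: XK.
have bK : {in K, forall x, e b x} by move=> x; apply: XK.
have ck x : {in K, forall y, e x y} -> #|x |: K| = r.-1.
  by move=> xK; rewrite cardsU1 (nbr_notin xK) cK; move: r3; alia.
have [|B [cB qB DB XB]] := @exists_clique r.-1 [set u; v] (F :|: (a |: (b |: K))).
  apply: (@leq_ltn_trans ((2 + r.-1) * M + (#|F| + r))).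
    rewrite cards2 uv leq_add2l (leq_trans (leq_card_setU _ _)) // leq_add2l.
    rewrite cardsU1 cardsU1 cK; move: r3; have := leq_b1 (a \notin b |: K); have := leq_b1 (b \notin K); alia.
  have -> : 2 + r.-1 = r.+1 by move: r3; alia.
  by move: lt; alia.
have uB : {in B, forall x, e u x} by move=> x; apply: XB; rewrite !inE eqxx.
have vB : {in B, forall x, e v x} by move=> x; apply: XB; rewrite !inE eqxx orbT.
have BF x : x \in B -> [/\ x \notin F, x != a, x != b & x \notin K].
  by move/(disjointFr DB)/negbT; rewrite !inE !negb_or => /and4P[].
have key x : x \in X -> x \notin F -> e u x -> e v x -> {in K, forall y, e x y} ->
    (forall y, y \in B -> y != x) ->
    \sum_(y in x |: K) (f [set u; y] == c) + \sum_(y in B) (f [set v; y] == c) =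
    \sum_(y in x |: K) (f [set v; y] == c) + \sum_(y in B) (f [set u; y] == c).
  move=> xX xF ux vx xK yx.
  have D : [disjoint x |: K & B].
    rewrite disjoint_sym disjoint_subset; apply/subsetP => y yB; rewrite !inE negb_or.
    by rewrite yx //; case: (BF y yB).
  have nb w : w \in X -> e w x -> {in B, forall y, e w y} -> {in (x |: K) :|: B, forall y, e w y}.
    by move=> wX wx wB y /setUP[/setU1P[->//|yK]|/wB//]; apply: XK.
  apply: exchange => //; [exact: cliqueU1|exact: ck|exact: nb|exact: nb|].
  apply: N; rewrite disjoint_subset; apply/subsetP => y /setU1P[->//|/setU1P[->//|]].
  case/setUP=> [/setU1P[->//|yK]|/BF[]//].
  by rewrite inE (disjointFr DK).
have Ea := key a aX aF ua va aK (fun y yB => let: And4 _ h _ _ := BF y yB in h).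
have Eb := key b bX bF ub vb bK (fun y yB => let: And4 _ _ h _ := BF y yB in h).
move: Ea Eb; rewrite !big_setU1 ?(nbr_notin aK) ?(nbr_notin bK) //=.
alia.
Qed.

End Degree.
End Tilings.

(** Here [s] is the number of edges in the other q - 1 colours of the first tiling. If no count
    reaches E / q + G / q^2, then [c1] is above E / q - (q - 1) G / q^2, so the gap is below G /
    q. *)
Lemma leq_ratio_tiling q E G d c1 c2 s :
  0 < q -> q ^ 2 * c2 < q * E + G -> c1 + d <= c2 -> c1 + s = E ->
  q ^ 2 * s + q.-1 <= q.-1 * (q * E + G) -> q * d < G.
Proof.
case: q => // q _ H1 H2 H3 H4; rewrite -(ltn_pmul2l (ltn0Sn q)) mulnA mulnn.
have H5 : q.+1 ^ 2 * (c1 + d) <= q.+1 ^ 2 * c2 by rewrite leq_mul2l H2 orbT.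
have H6 : q.+1 ^ 2 * c1 + q.+1 ^ 2 * s = q.+1 ^ 2 * E by rewrite -mulnDr H3.
have H7 : q.+1 * (q.+1 * E + G) = q.+1 ^ 2 * E + q.+1 * G.
  by rewrite mulnDr mulnA mulnn.
rewrite mulnDr in H5; rewrite [LHS]mulSn in H7; rewrite [_.-1]/= in H4.
move: (q.+1 * E + G) H1 H4 H7 => y; move: (q.+1 ^ 2) H5 H6 => Q.
move: (q * y) => qy; rewrite -[q.+1 * G]addn0; alia.
Qed.

(** * Finding an unbalanced tiling *)

Section Unbalanced.
Variables (V : finType) (q r M G : nat) (e : rel V) (f : {set V} -> 'I_q).
Hypotheses (esym : symmetric e) (eirr : irreflexive e).
Hypotheses (r3 : 3 <= r) (q2 : 2 <= q).
Hypothesis nondeg : forall x, #|[set y | ~~ e x y]| <= M.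
Hypothesis rV : r %| #|V|.
Hypothesis sizeV : r.+1 * M + (4 * r + 1) * G + r < #|V|.
Local Notation tcount := (tiling_count f).
Local Notation tiling := (tiling r e).
Local Notation gadget := (gadget r e f).

Let r0 : 0 < r. Proof. exact: leq_trans r3. Qed.
Let N := #|V| %/ r.
Let E := N * 'C(r, 2).

Lemma tiling_total P : tiling [set: V] P -> \sum_c tcount P c = E.
Proof.
move=> tP; rewrite (tiling_edges _ tP) /E /N -cardsT -(tiling_card tP).
by rewrite mulnK.
Qed.

(** The inequality in the conclusion is the condition for discrepancy at least G / q with all
    denominators cleared. *)
Lemma unbalanced_of_gap P1 P2 c d : tiling [set: V] P1 -> tiling [set: V] P2 ->
    tcount P1 c + d <= tcount P2 c -> G <= q * d ->
  exists P c', tiling [set: V] P /\ q * E + G <= q ^ 2 * tcount P c'.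
Proof.
move=> t1 t2 le Gd.
case: (boolP [exists P, exists c', tiling [set: V] P && (q * E + G <= q ^ 2 * tcount P c')]).
  by case/existsP=> P /existsP[c' /andP[tP H]]; exists P, c'.
rewrite negb_exists => /forallP H.
have {}H P c' : tiling [set: V] P -> q ^ 2 * tcount P c' < q * E + G.
  move=> tP; have := H P; rewrite negb_exists => /forallP/(_ c').
  by rewrite tP /= -ltnNge.
have := tiling_total t1; rewrite (bigD1 c) //= => Es.
suff : q * d < G by rewrite ltnNge Gd.
apply: (leq_ratio_tiling _ (H P2 c t2) le Es); first exact: leq_trans q2.
rewrite big_distrr /= -[q.-1 in X in X <= _]muln1.
have -> : q.-1 = #|[pred i : 'I_q | i != c]|.
  by have := cardC1 c; rewrite card_ord => <-.
rewrite -!sum_nat_const -big_split /=; apply: leq_sum => i _.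
by rewrite addn1; apply: H.
Qed.

Lemma exists_gadget_family : exists Gs : {set {set V}},
  [/\ trivIset Gs, forall Z, Z \in Gs -> gadget Z, #|Gs| <= G &
      #|Gs| = G \/ forall Z : {set V}, [disjoint Z & cover Gs] -> ~~ gadget Z].
Proof.
pose ok (Gs : {set {set V}}) := [&& trivIset Gs, [forall Z in Gs, gadget Z] & #|Gs| <= G].
have ok0 : ok set0.
  rewrite /ok cards0 leq0n andbT; apply/andP; split.
    by apply/trivIsetP => A B; rewrite inE.
  by apply/forall_inP => Z; rewrite inE.
case: (@arg_maxnP _ set0 ok (fun Gs => #|Gs|) ok0) => Gs /and3P[tG /forall_inP gG leG] Gmax.
exists Gs; split=> //; have [->|neG] := eqVneq #|Gs| G; [by left | right].
move=> Z DZ; apply/negP => gZ.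
have Z0 : Z != set0.
  by apply: contraTneq gZ => ->; rewrite /gadget cards0 eq_sym muln_eq0 /= (gtn_eqF r0).
have ZG : Z \notin Gs.
  apply: contraNN Z0 => ZG; rewrite -subset0 -(disjoint_setI0 DZ) subsetI subxx.
  exact: bigcup_sup ZG.
have := Gmax (Z |: Gs); rewrite /= cardsU1 ZG add1n ltnn => H; apply/negP: isT.
move: H; case: (boolP (ok _)) => [_ /(_ isT)//|/negP[]]; apply/and3P; split.
- apply/trivIsetP => A B /setU1P[->|AG] /setU1P[->|BG] AB.
  + by rewrite eqxx in AB.
  + by apply: disjointWr DZ; apply: bigcup_sup BG.
  + by rewrite disjoint_sym; apply: disjointWr DZ; apply: bigcup_sup AG.
  + by move/trivIsetP: tG; apply.
- by apply/forall_inP => A /setU1P[->|/gG].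
- by rewrite cardsU1 ZG add1n ltn_neqAle neG.
Qed.

Lemma cover_gadgets (Gs : {set {set V}}) : trivIset Gs -> (forall Z, Z \in Gs -> gadget Z) ->
  #|cover Gs| = #|Gs| * (2 * r).
Proof.
move=> tG gG; apply: card_uniform_partition (_ : finset.partition Gs (cover Gs)).
  by move=> Z /gG/andP[/eqP].
rewrite /finset.partition eqxx tG /=; apply/negP => /gG/andP[].
by rewrite cards0 eq_sym muln_eq0 /= (gtn_eqF r0).
Qed.

Lemma exists_unbalanced_tiling :
  exists P c, tiling [set: V] P /\ q * E + G <= q ^ 2 * tcount P c.
Proof.
have [Gs [tG gG leG alt]] := exists_gadget_family.
have cG := cover_gadgets tG gG.
pose W := ~: cover Gs.
have cW : #|W| + #|Gs| * (2 * r) = #|V| by rewrite -cG addnC cardsC.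
have DW : [disjoint W & cover Gs] by rewrite disjoint_sym disjoints_subset setCK.
have UW : W :|: cover Gs = [set: V] by rewrite setUC setUCr.
have rG : #|Gs| * (2 * r) <= 2 * r * G by rewrite mulnC leq_mul2l leG orbT.
have [P0 tP0] : exists P0, tiling W P0.
  apply: (exists_tiling esym eirr r0).
    rewrite -(dvdn_addl #|W| (_ : r %| #|Gs| * (2 * r))) ?cW //.
    by rewrite mulnA dvdn_mull.
  move=> x; apply: (@leq_trans (r * M)); first by rewrite leq_mul2l nondeg orbT.
  move: sizeV cW rG; rewrite mulSn mulnDl mul1n; have : 2 * r * G <= 4 * r * G by rewrite !leq_mul2r; alia.
  alia.
have glue P : tiling (cover Gs) P -> tiling [set: V] (P0 :|: P) /\
    forall c, tcount (P0 :|: P) c = tcount P0 c + tcount P c.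
  by move=> tP; rewrite -UW; apply: tilingU.
have gap Z : Z \in Gs -> exists P1 P2 c, [/\ tiling Z P1, tiling Z P2 & tcount P1 c < tcount P2 c].
  move/gG/andP=> [_ /existsP[P1 /existsP[P2 /and3P[t1 t2 /existsP[c lt]]]]].
  by exists P1, P2, c.
case: alt => [GE|noG].
  pose gc (Z : {set V}) c := [exists P1, exists P2, [&& tiling Z P1, tiling Z P2 & tcount P1 c < tcount P2 c]].
  (* Each of the [G] gadgets is distinguished by at least one of the q colours. *)
  have [c cc] : exists c, G <= q * \sum_(Z in Gs) gc Z c.
    case: (boolP [exists c, G <= q * \sum_(Z in Gs) gc Z c]) => [/existsP//|].
    rewrite negb_exists => /forallP none; exfalso.
    have q0 : 0 < q by apply: leq_trans q2.
    have : \sum_(c : 'I_q) (q * \sum_(Z in Gs) gc Z c).+1 <= \sum_(c : 'I_q) G.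
      by apply: leq_sum => c _; rewrite ltnNge.
    rewrite sum_nat_const card_ord; apply/negP; rewrite -ltnNge.
    apply: (@leq_ltn_trans (q * \sum_(c : 'I_q) \sum_(Z in Gs) gc Z c)).
      rewrite leq_mul2l exchange_big -{1}GE -sum1_card /=; apply/orP; right.
      apply: leq_sum => Z /gap[P1 [P2 [c [t1 t2 lt]]]].
      rewrite (bigD1 c) //= /gc; apply: leq_trans (leq_addr _ _).
      by case: existsP => // [[]]; exists P1; apply/existsP; exists P2; rewrite t1 t2.
    rewrite big_distrr /=.
    under [X in _ < X]eq_bigr do rewrite -addn1.
    by rewrite big_split /= sum1_card card_ord -[X in X < _]addn0 ltn_add2l.
  (* A gadget that [c] does not distinguish in this sense is tiled in the same way both times, with
     gap 0. *)
  have [|P1 [P2 [t1 t2 le]]] := @tiling_family _ q r e f Gs c (fun Z => gc Z c : nat) tG.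
    move=> Z ZG; rewrite /gc; case: existsP => [[P1 /existsP[P2 /and3P[t1 t2 lt]]]|_].
      by exists P1, P2; rewrite addn1.
    by have [P1 [_ [_ [t1 _ _]]]] := gap Z ZG; exists P1, P1; rewrite addn0.
  have [u1 e1] := glue _ t1; have [u2 e2] := glue _ t2.
  apply: (unbalanced_of_gap u1 u2 _ cc (c := c)).
  by rewrite e1 e2 -addnA leq_add2l.
have [||b [S [SW Sind Sb]]] := @rigid_structure V q e f W esym.
- move=> x y z t; have [|w wF H] := @common_nbr_avoiding V e M nondeg [set x; y; z; t] (cover Gs).
    have c4 : #|[set x; y; z; t]| <= 4.
      by rewrite -!setUA !cardsU1 cards1; do 3!case: (_ \notin _).
    apply: (@leq_ltn_trans (r.+1 * M + 2 * r * G)).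
      by rewrite leq_add ?cG // leq_mul2r (leq_trans c4) ?orbT.
    move: sizeV; rewrite mulnDl; have : 2 * r * G <= 4 * r * G by rewrite !leq_mul2r; alia.
    alia.
  exists w; first by rewrite inE.
  by rewrite ![e w _]esym !H // !inE eqxx ?orbT.
- move=> u v a a' uW vW aW bW ua va ub vb c.
  apply: (@rigid_of_no_gadget V q r e f esym eirr M nondeg (cover Gs)) => //; try by rewrite -in_setC.
  rewrite cG; move: sizeV rG; rewrite mulnDl; have : 2 * r * G <= 4 * r * G by rewrite !leq_mul2r; alia.
  alia.
have SM : #|S| <= M.
  have [->|[x xS]] := set_0Vmem S; first by rewrite cards0.
  apply: leq_trans (nondeg x); apply: subset_leq_card; apply/subsetP => y yS.
  by rewrite inE Sind.
(* A clique has at most one vertex in the independent set [S]; only the r - 1 edges at that vertex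
   can miss the colour [b]. *)
have block B : B \in P0 -> 'C(r, 2) <= colour_count f B b + r.-1 * \sum_(x in B) (x \in S).
  move=> BP; have [pP /(_ B BP)[cB eB]] := tilingP _ _ _ _ tP0.
  have BW : {subset B <= W} by apply/subsetP/(partitionS pP).
  case: (boolP [exists x in B, x \in S]) => [/exists_inP[x xB xS]|].
    have H : colour_count f (B :\ x) b = 'C(#|B :\ x|, 2).
      apply: colour_count_mono => y z /setD1P[yx yB] /setD1P[zx zB] yz; apply/eqP.
      have NS w : w \in B -> w != x -> w \notin S.
        by move=> wB wx; apply/negP => wS; have := Sind _ _ wS xS; rewrite eB.
      apply/negPn/negP => /(Sb y z (BW _ yB) (BW _ zB) (eB _ _ yB zB yz)).
      by rewrite (negPf (NS _ yB yx)) (negPf (NS _ zB zx)).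
    have := leq_colour_count f b (subsetDl B [set x]); rewrite H.
    have -> : #|B :\ x| = r.-1 by have := cardsD1 x B; rewrite cB xB; move: r0; alia.
    have -> : 'C(r, 2) = 'C(r.-1, 2) + r.-1 by rewrite -{1}(prednK r0) binS bin1.
    by move=> le; rewrite (bigD1 x) //= xS leq_add // mulnDr muln1 leq_addr.
  rewrite negb_exists_in => /forall_inP H.
  rewrite colour_count_mono ?cB ?leq_addr // => y z yB zB yz; apply/eqP.
  apply/negPn/negP => /(Sb y z (BW _ yB) (BW _ zB) (eB _ _ yB zB yz)).
  by rewrite (negPf (H _ yB)) (negPf (H _ zB)).
have bP0 : #|P0| * 'C(r, 2) <= tcount P0 b + r.-1 * M.
  rewrite -sum_nat_const; apply: leq_trans (leq_sum _ block) _.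
  rewrite big_split leq_add2l -big_distrr leq_mul2l /=; apply/orP; right.
  have [pP _] := tilingP _ _ _ _ tP0; rewrite -(set_partition_big _ pP) /=.
  apply: leq_trans SM; rewrite -sum1_card big_mkcond [X in _ <= X]big_mkcond.
  by apply: leq_sum => x _; case: (x \in W); case: (x \in S).
have [P1 tP1] : exists P1, tiling (cover Gs) P1.
  have [|P1 [_ [t1 _ _]]] := @tiling_family _ q r e f Gs b (fun=> 0) tG; last by exists P1.
  by move=> Z /gap[P1 [_ [_ [t1 _ _]]]]; exists P1, P1; rewrite addn0.
have [u1 e1] := glue _ tP1; exists (P0 :|: P1), b; split=> //; rewrite e1.
have cP0 := tiling_card tP0.
have NE : N = #|P0| + 2 * #|Gs|.
  by rewrite /N -cW -cP0 mulnCA mulnA -mulnDl mulnK // mulnC.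
have C2 : 'C(r, 2) * 2 = r * r.-1 by have := bin_ffact r 2; rewrite ffactnS ffactn1.
(* Even if all edges inside the gadgets miss the colour [b], it has at least (E + G) / 2 edges,
   which suffices as q >= 2. Doubling clears the binomials and leads to [key], which follows from 4
   <= r + 1 and from the coefficient [4 * r + 1] of [G] in [sizeV]. *)
have main : E + G <= 2 * (tcount P0 b + tcount P1 b).
  have Nr : N * r = #|V| by rewrite /N divnK.
  have s2 : 2 <= r.-1 by move: r3; alia.
  have key : 2 * G + 4 * G * (r * r.-1) + 4 * (r.-1 * M) <= N * (r * r.-1).
    have lb : 4 * M + (4 * r + 1) * G <= N * r.
      rewrite Nr; have : 4 * M <= r.+1 * M by rewrite leq_mul2r ltnS r3 orbT.
      by move: sizeV; alia.
    have lb2 : (4 * M + (4 * r + 1) * G) * r.-1 <= N * r * r.-1 by rewrite leq_mul2r lb orbT.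
    rewrite [X in _ <= X]mulnA; apply: leq_trans lb2.
    have : 2 * G <= r.-1 * G by rewrite leq_mul2r s2 orbT.
    by alia.
  rewrite /E NE; rewrite NE in key.
  have gC : #|Gs| * 'C(r, 2) <= G * 'C(r, 2) by rewrite leq_mul2r leG orbT.
  by move: key bP0 gC; rewrite -C2; alia.
apply: (@leq_trans (q * (E + G))); first by rewrite mulnDr leq_add2l leq_pmull // (leq_trans _ q2).
rewrite expnS expn1 -mulnA leq_mul2l; apply/orP; right.
by apply: leq_trans main _; rewrite leq_mul2r q2 orbT.
Qed.

End Unbalanced.

(** * The extremal colouring *)

Section Multipartite.
Variables (r q k L : nat).
Local Notation V := (option 'I_r * 'I_L)%type.
Variables (g1 : {set option 'I_r} -> 'I_q) (g2 : 'I_L -> 'I_q).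

Definition multipartite : rel V := [rel x y | x.1 != y.1].

(* The part None is the one whose vertices choose the colour of their edges. *)
Definition multipartite_colour (E : {set V}) : 'I_q :=
  if [pick v in E | v.1 == None] is Some v then g2 v.2 else g1 [set x.1 | x in E].

Let f := multipartite_colour.
Definition inner_pairs := pairs [set i : option 'I_r | i != None].

Lemma multipartite_simple : simple_graph multipartite.
Proof. by split=> [x y|x]; rewrite /multipartite /= ?eqxx // eq_sym. Qed.

Lemma card_multipartite : #|{: V}| = r.+1 * L.
Proof. by rewrite card_prod card_option !card_ord. Qed.

Lemma card_part i : #|[set x : V | x.1 == i]| = L.
Proof.
have -> : [set x : V | x.1 == i] = setX [set i] setT.
  by apply/setP => -[j l]; rewrite !inE andbT.
by rewrite cardsX cards1 cardsT card_ord mul1n.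
Qed.

Lemma multipartite_degree v : #|[set w | multipartite v w]| = r * L.
Proof.
have := cardsC [set x : V | x.1 == v.1]; rewrite card_part card_multipartite mulSn.
move/addnI <-; apply: eq_card => w; by rewrite !inE /multipartite /= eq_sym.
Qed.

Lemma colour_last v x : v.1 = None -> x.1 != None -> f [set v; x] = g2 v.2.
Proof.
move=> v1 x1; rewrite /f /multipartite_colour; case: pickP => [w|/(_ v)].
  by rewrite !inE => /andP[/orP[]/eqP-> // /eqP E]; rewrite E in x1.
by rewrite !inE eqxx v1 eqxx.
Qed.

(** Projection to the parts is injective on [B], so the edges inside [B] correspond to the pairs of
    parts that it meets. *)
Lemma colour_count_inner (B : {set V}) c : {in B &, injective fst} ->
    {in B, forall x, x.1 != None} ->
  colour_count f B c = #|[set p in inner_pairs | (g1 p == c) && (p \subset [set x.1 | x in B])]|.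
Proof.
move=> inj BN.
have fE (E : {set V}) : E \subset B -> f E = g1 [set x.1 | x in E].
  move=> /subsetP EB; rewrite /f /multipartite_colour; case: pickP => // v.
  by case/andP=> /EB/BN/negPf->.
have injE (E : {set V}) : E \subset B -> #|[set x.1 | x in E]| = #|E|.
  by move=> /subsetP EB; apply: card_in_imset => x y /EB xB /EB yB; apply: inj.
rewrite /colour_count -(card_in_imset (f := fun E : {set V} => [set x.1 | x in E])); last first.
  have sub (E F : {set V}) : E \subset B -> F \subset B -> [set x.1 | x in E] = [set x.1 | x in F] -> E \subset F.
    move=> /subsetP EB /subsetP FB EF; apply/subsetP => x xE.
    have : x.1 \in [set x.1 | x in F] by rewrite -EF imset_f.
    by case/imsetP=> y yF xy; rewrite (inj x y (EB x xE) (FB y yF) xy).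
  move=> E F; rewrite !inE => /andP[/andP[EB _] _] /andP[/andP[FB _] _] EF.
  by apply/eqP; rewrite eqEsubset (sub E F EB FB EF) (sub F E FB EB (Logic.eq_sym EF)).
apply: eq_card => p; apply/imsetP/idP => [[E]|].
  rewrite !inE => /andP[/andP[EB E2] /eqP fc] ->; rewrite -fE // fc eqxx injE // E2 imsetS // !andbT.
  by apply/subsetP => i /imsetP[x xE ->]; rewrite inE BN //; apply: (subsetP EB).
rewrite !inE => /and3P[/andP[_ p2] /eqP pc pB].
pose E := [set x in B | x.1 \in p].
have EB : E \subset B by apply/subsetP => x; rewrite inE => /andP[].
have pE : p = [set x.1 | x in E].
  apply/setP => i; apply/idP/imsetP => [ip|[x]]; last by rewrite inE => /andP[_ xp] ->.
  by have /imsetP[x xB ix] := subsetP pB i ip; exists x; rewrite // inE xB -ix.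
by exists E; rewrite // !inE EB fE // -pE pc eqxx -injE // -pE p2.
Qed.

Lemma colour_count_block (B : {set V}) c : 0 < r -> #|B| = r -> {in B &, injective fst} ->
  colour_count f B c =
    \sum_(p in inner_pairs) ((g1 p == c) && (p \subset [set x.1 | x in B])) +
    r.-1 * \sum_(v in B) ((v.1 == None) && (g2 v.2 == c)).
Proof.
move=> r0 cB inj; rewrite -card_set_sum.
pose B' := [set x in B | x.1 != None].
have B'B : B' \subset B by apply/subsetP => x; rewrite inE => /andP[].
have B'N : {in B', forall x, x.1 != None} by move=> x; rewrite inE => /andP[].
have inj' : {in B' &, injective fst}.
  by move=> x y /(subsetP B'B) xB /(subsetP B'B) yB; apply: inj.
have -> : #|[set p in inner_pairs | (g1 p == c) && (p \subset [set x.1 | x in B])]| =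
    colour_count f B' c.
  rewrite colour_count_inner //; apply: eq_card => p; rewrite ![p \in [set _ in _ | _]]inE.
  case: (boolP (p \in inner_pairs)) => //=; rewrite inE => /andP[/subsetP pN _].
  congr (_ && _); apply/idP/idP => [/subsetP H|/subset_trans]; last by apply; apply: imsetS.
  apply/subsetP => i ip; have /imsetP[x xB ix] := H i ip.
  by apply/imsetP; exists x; rewrite // inE xB -ix; have := pN i ip; rewrite inE.
case: (boolP [exists v in B, v.1 == None]) => [/exists_inP[v vB /eqP vN]|].
  have BE : B = v |: B'.
    apply/setP => x; rewrite !inE; apply/idP/orP => [xB|[/eqP->|/andP[]]//].
    case: (eqVneq x.1 None) => xN; last by right; rewrite xB.
    by left; apply/eqP/inj; rewrite ?xN ?vN.
  have vB' : v \notin B' by rewrite inE vN eqxx andbF.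
  rewrite {1}BE colour_countU1 //; congr (_ + _).
  rewrite [X in _ = _ * X](bigD1 v) //= vN eqxx [X in _ * (_ + X)]big1 ?addn0 => [|x /andP[xB xv]]; last first.
    have xB' : x \in B' by move: xB; rewrite BE !inE (negPf xv).
    by rewrite (negPf (B'N x xB')).
  have <- : #|B'| = r.-1.
    by have := cardsU1 v B'; rewrite -BE vB' add1n => E; rewrite -[LHS]/(#|B'|.+1.-1) -E cB.
  rewrite -sum_nat_const; apply: eq_bigr => x /B'N xN.
  by rewrite colour_last.
rewrite negb_exists_in => /forall_inP BN.
have -> : B' = B by apply/setP => x; rewrite inE; case: (boolP (x \in B)) => // /BN.
by rewrite [X in _ * X]big1 ?muln0 ?addn0 // => x /BN/negPf->.
Qed.

Lemma tiling_inj P B : is_Kr_tiling multipartite r P -> B \in P ->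
  #|B| = r /\ {in B &, injective fst}.
Proof.
move=> tP BP; have [_ /(_ B BP)[cB eB]] := tilingP _ _ _ _ tP; split=> // x y xB yB.
by apply: contra_eq => xy; apply: eB.
Qed.

Lemma sum_blocks P (F : V -> nat) : is_Kr_tiling multipartite r P ->
  \sum_(B in P) \sum_(x in B) F x = \sum_x F x.
Proof.
move=> tP; have [pP _] := tilingP _ _ _ _ tP.
by rewrite -(set_partition_big _ pP); apply: eq_bigl => x; rewrite inE.
Qed.

Lemma blocks_meeting_part P i : is_Kr_tiling multipartite r P ->
  \sum_(B in P) (i \in [set x.1 | x in B]) = L.
Proof.
move=> tP; transitivity #|[set x : V | x.1 == i]|; last exact: card_part.
rewrite -sum1_card [RHS]big_mkcond /=.
under [RHS]eq_bigr => x _ do rewrite inE.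
rewrite -(sum_blocks _ tP); apply: eq_bigr => B BP.
have [_ inj] := tiling_inj tP BP.
case: (boolP (i \in _)) => [/imsetP[x xB ->]|N].
  rewrite (bigD1 x) //= eqxx big1 // => y /andP[yB yx]; case: ifP => // /eqP E.
  by rewrite (inj _ _ yB xB E) eqxx in yx.
by rewrite big1 // => y yB; case: ifP => // /eqP E; rewrite -E imset_f in N.
Qed.

(** A block meets r of the r + 1 parts, so it misses at most one of [i] and [j]: the two indicators
    add up to 1 plus the indicator of both. *)
Lemma blocks_meeting_pair P i j : is_Kr_tiling multipartite r P -> i != j ->
  \sum_(B in P) ([set i; j] \subset [set x.1 | x in B]) + #|P| = 2 * L.
Proof.
move=> tP ij; transitivity (\sum_(B in P) (i \in [set x.1 | x in B]) +
    \sum_(B in P) (j \in [set x.1 | x in B])); last first.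
  by rewrite !blocks_meeting_part // mul2n addnn.
rewrite -sum1_card -!big_split /=.
apply: eq_bigr => B BP; have [cB inj] := tiling_inj tP BP.
rewrite subUset !sub1set.
set Q := [set x.1 | x in B]; have cQ : #|Q| = r by rewrite card_in_imset.
case: (boolP (i \in Q)) => iQ; case: (boolP (j \in Q)) => jQ //=; exfalso.
have : #|i |: (j |: Q)| <= #|[set: option 'I_r]| by apply: subset_leq_card; apply: subsetT.
by rewrite !cardsU1 !inE (negPf ij) (negPf iQ) jQ cQ cardsT card_option card_ord /= ltnn.
Qed.

Lemma multipartite_count P c m n1 : 0 < r -> is_Kr_tiling multipartite r P ->
    \sum_(p in inner_pairs) (g1 p == c) = n1 -> \sum_l (g2 l == c) = m ->
  tiling_count f P c + n1 * #|P| = n1 * (2 * L) + r.-1 * m.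
Proof.
move=> r0 tP S1 S2.
have -> : tiling_count f P c = \sum_(p in inner_pairs) ((g1 p == c) *
    \sum_(B in P) (p \subset [set x.1 | x in B])) + r.-1 * m.
  rewrite /tiling_count; under eq_bigr => B BP.
    by have [cB inj] := tiling_inj tP BP; rewrite colour_count_block //; over.
  rewrite big_split -big_distrr /= sum_blocks //; congr (_ + _ * _).
    rewrite exchange_big; apply: eq_bigr => p _; rewrite big_distrr /=.
    by apply: eq_bigr => B _; case: (g1 p == c); rewrite ?mul1n ?mul0n.
  rewrite -S2 (eq_bigr (fun v : V => ((v.1 == None) && (g2 v.2 == c)) : nat)) //.
  rewrite -(pair_bigA _ (fun i l => ((i == None) && (g2 l == c)) : nat)) /=.
  rewrite (bigD1 None) //= [X in _ + X]big1 ?addn0 // => i /negPf iN.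
  by rewrite big1 // => l _; rewrite iN.
rewrite addnAC; congr (_ + _); rewrite -S1 !big_distrl -big_split /=.
apply: eq_bigr => p; rewrite inE => /andP[_ /eqP/set2_card[i [j [ij ->]]]].
by rewrite -mulnDr blocks_meeting_pair.
Qed.

End Multipartite.

(** With parts of size [L] = r q k there are (r + 1) q k blocks, so each pair of parts is used 2 L -
    (r + 1) q k = (r - 1) q k times, and each vertex of the last part has r - 1 edges. A colour with
    [n1] pairs and [m] vertices thus has (r - 1) (q k n1 + m) edges, and [m] is chosen to make this
    constant. *)
Lemma exists_balanced (r q a b k : nat) : 0 < r -> 0 < q ->
    'C(r, 2) = a * q + b -> b < q -> q <= r + b \/ b = 0 ->
  exists (V : finType) (e : rel V) (f : {set V} -> 'I_q),
    [/\ #|V| = r.+1 * (r * q * k), simple_graph e,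
        forall v, #|[set w | e v w]| = r * (r * q * k) &
        forall P, is_Kr_tiling e r P -> forall c d,
          tiling_count f P c = tiling_count f P d].
Proof.
move=> r0 q0 Cr bq H; pose L := r * q * k.
pose n1 (c : 'I_q) := a + (c < b).
have sn1 : \sum_c n1 c = 'C(r, 2).
  rewrite big_split /= sum_nat_const card_ord Cr mulnC; congr (_ + _).
  rewrite -(big_mkord predT (fun i => (i < b) : nat)) (big_cat_nat (n := b)) //=; last exact: ltnW.
  rewrite [X in _ + X]big_nat_cond [X in _ + X]big1 ?addn0 => [|i]; last first.
    by rewrite andbT => /andP[bi _]; rewrite ltnNge bi.
  rewrite big_nat_cond (eq_bigr (fun=> 1)) => [|i]; last by rewrite andbT => /andP[_ ->].
  by rewrite -big_nat_cond sum_nat_const_nat subn0 muln1.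
(* This keeps [m] from being truncated. For a colour with a + 1 pairs it amounts to q <= r + b, and
   for b = 0 there is no such colour. *)
have n1q c : n1 c * q <= 'C(r, 2) + r.
  rewrite /n1 Cr mulnDl -addnA leq_add2l.
  by case: H => H; case: (ltnP c b) => cb; move: cb H; rewrite ?mul1n ?mul0n; alia.
pose m (c : 'I_q) := k * ('C(r, 2) + r - n1 c * q).
have sm : \sum_c m c = L.
  have : \sum_c (m c + k * (n1 c * q)) = \sum_(c < q) k * ('C(r, 2) + r).
    by apply: eq_bigr => c _; rewrite -mulnDr subnK.
  rewrite big_split sum_nat_const card_ord /=.
  have -> : \sum_c k * (n1 c * q) = k * ('C(r, 2) * q).
    by rewrite -sn1 big_distrl big_distrr.
  by rewrite /L; nia.
have [|g1 G1] := @exists_fibers _ 'I_q (Ordinal q0) (inner_pairs r) n1.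
  rewrite sn1 card_pairs; congr 'C(_, 2).
  have -> : [set i : option 'I_r | i != None] = [set~ None] by apply/setP => i; rewrite !inE.
  by rewrite cardsC1 card_option card_ord.
have [|g2 G2] := @exists_fibers _ 'I_q (Ordinal q0) [set: 'I_L] m.
  by rewrite sm cardsT card_ord.
exists (option 'I_r * 'I_L)%type, (@multipartite r L), (multipartite_colour g1 g2).
split; [exact: card_multipartite|exact: multipartite_simple|exact: multipartite_degree|].
move=> P tP; pose T := r.-1 * (k * ('C(r, 2) + r)).
suff cT c : tiling_count (multipartite_colour g1 g2) P c = T by move=> c d; rewrite !cT.
have S2 : \sum_l (g2 l == c) = m c.
  by rewrite -G2; apply: eq_bigl => l; rewrite inE.
have := multipartite_count r0 tP (G1 c) S2.
have Pr : #|P| = r.+1 * (q * k).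
  have := tiling_card tP; rewrite cardsT card_multipartite /L.
  have -> : r.+1 * (r * q * k) = r.+1 * (q * k) * r by nia.
  by move/eqP; rewrite eqn_pmul2r // => /eqP.
have mE : m c + k * (n1 c * q) = k * ('C(r, 2) + r) by rewrite -mulnDr subnK.
have -> : n1 c * (2 * L) = n1 c * #|P| + r.-1 * (k * (n1 c * q)).
  have -> : 2 * L = #|P| + r.-1 * (k * q).
    by rewrite Pr /L; case: (r) r0 => // r' _; rewrite [r'.+1.-1]/=; nia.
  by rewrite mulnDr; nia.
move=> E; apply/eqP; rewrite -(eqn_add2r (n1 c * #|P|)) E /T -mE [X in _ == X + _]mulnDr.
by rewrite -addnA addnC [X in X + _ == _]addnC.
Qed.

(** * The threshold *)

(** The third hypothesis is d >= (r / (r + 1) + 1 / t) n without denominators. After multiplication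
    by [t] it leaves a slack of (r + 1) n, of which the gadgets use at most n, because 4 r + 1 <= 8
    r, and the term [r] uses less than r n. *)
Lemma size_bound r t n d G : 0 < r -> 0 < t -> d <= n ->
    t * r * n + (r + 1) * n <= t * (r + 1) * d -> G * (8 * r * t) <= n -> t < n ->
  r.+1 * (n - d) + (4 * r + 1) * G + r < n.
Proof.
move=> r0 t0 dn md GD tn.
have Mn : t * r.+1 * (n - d) + r.+1 * n <= t * n.
  have E : t * r.+1 * n = t * n + t * r * n by nia.
  have le : t * r.+1 * d <= t * r.+1 * n by rewrite leq_mul2l dn orbT.
  by rewrite mulnBr; rewrite addn1 in md; lia.
have Gn : t * ((4 * r + 1) * G) <= n.
  have : (4 * r + 1) * (G * t) <= 8 * r * (G * t) by apply: leq_mul => //; lia.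
  by lia.
have trn : t * r < r * n by rewrite mulnC ltn_mul2l r0.
have rn : r.+1 * n = r * n + n by rewrite mulSn addnC.
rewrite -(ltn_pmul2l t0) mulnDr [t * (_ + _)]mulnDr [t * (r.+1 * _)]mulnA.
by move: (t * r.+1 * (n - d)) Mn => x Mn; lia.
Qed.

Lemma leq_min_degree (V : finType) (e : rel V) m : m <= #|V| ->
  (forall v, m <= #|[set w | e v w]|) -> m <= min_degree e.
Proof.
move=> mV md; rewrite /min_degree; elim/big_ind: _ => // x y mx my.
by rewrite leq_min mx.
Qed.

Lemma min_degree_leq (V : finType) (e : rel V) v : min_degree e <= #|[set w | e v w]|.
Proof.
rewrite /min_degree; have := mem_index_enum v; elim: (index_enum V) => // x s IH.
rewrite inE big_cons => /orP[/eqP->|/IH]; first exact: geq_minl.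
by move=> le; apply: leq_trans (geq_minr _ _) le.
Qed.

Lemma card_edges_tiling (V C : finType) (f : {set V} -> C) (P : {set {set V}}) D :
  finset.partition P D -> #|edges (tiling_graph P)| = \sum_c tiling_count f P c.
Proof.
move=> pP; rewrite -(sum_card_fibers _ f).
by apply: eq_bigr => c _; rewrite (edges_tiling f pP).
Qed.

From mathcomp Require Import boolp classical_sets filter.
Import Order.TTheory GRing.Theory Num.Theory.
Local Open Scope ring_scope.
Local Open Scope classical_set_scope.

(** * Discrepancy in terms of colour counts *)

Section Discrepancy.
Variables (R : realType) (V : finType) (q : nat) (f : {set V} -> 'I_q).
Variables (P : {set {set V}}) (D : {set V}).
Hypotheses (q0 : (0 < q)%N) (pP : finset.partition P D).
Let qR : 0 < q%:R :> R. Proof. by rewrite ltr0n. Qed.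

Lemma discrepancy_balanced :
    (forall c d, tiling_count f P c = tiling_count f P d) ->
  discrepancy R (tiling_graph P) f <= 0.
Proof.
move=> bal; have cE c : #|edges (tiling_graph P)|%:R = q%:R * (tiling_count f P c)%:R :> R.
  rewrite (card_edges_tiling f pP) (eq_bigr (fun=> tiling_count f P c)) => [|d _]; last exact: bal.
  by rewrite sum_nat_const card_ord natrM.
apply: ge_sup.
  (* The value 0 is attained, so the set under [sup] is nonempty, as [ge_sup] requires. *)
  exists 0; exists (Ordinal q0); rewrite (edges_tiling f pP) (cE (Ordinal q0)).
  by rewrite addr0 mulrAC divff ?mul1r ?gt_eqF.
move=> t [c]; rewrite (edges_tiling f pP) (cE c) ler_pdivrMr // mulrC; lra.
Qed.

Lemma discrepancy_ge c G :
    (q * #|edges (tiling_graph P)| + G <= q ^ 2 * tiling_count f P c)%N ->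
  G%:R / q%:R <= discrepancy R (tiling_graph P) f.
Proof.
move=> H; apply: ub_le_sup.
  (* An upper bound is needed for [sup] to be meaningful; no colour has more edges than the whole
     tiling. *)
  exists (q%:R * #|edges (tiling_graph P)|%:R) => t [d].
  rewrite ler_pdivrMr // mulrC => le.
  have le2 : q%:R * #|[set E in edges (tiling_graph P) | f E == d]%SET|%:R <=
      q%:R * #|edges (tiling_graph P)|%:R :> R.
    rewrite ler_pM2l // ler_nat; apply: subset_leq_card; apply/fintype.subsetP => E.
    by rewrite inE => /andP[].
  have := ler0n R #|edges (tiling_graph P)|; lra.
exists c; rewrite (edges_tiling f pP) ler_pdivrMr // -(ler_pM2l qR) mulrDr.
rewrite [_ * (_ / _)]mulrCA divff ?gt_eqF // mulr1.
by rewrite -!natrM -natrD ler_nat [X in (_ <= X)%N]mulnCA mulnn [X in (_ <= X)%N]mulnC.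
Qed.

End Discrepancy.

(** This repeats the condition under the infimum in [delta], so that the two sets are
    convertible. *)
Definition has_threshold (R : realType) (r q : nat) (d : R) :=
  0 < d /\ exists zeta : R, 0 < zeta /\
    \forall n \near \oo, (r %| n)%N ->
      forall (V : finType) (e : rel V) (f : {set V} -> 'I_q),
        #|V| = n -> simple_graph e -> d * n%:R <= (min_degree e)%:R ->
        exists P : {set {set V}},
          is_Kr_tiling e r P /\
          zeta * n%:R <= discrepancy R (tiling_graph P) f.

Lemma threshold_lower (R : realType) (r q a b : nat) (d : R) :
    (0 < r)%N -> (0 < q)%N -> 'C(r, 2) = (a * q + b)%N -> (b < q)%N ->
    (q <= r + b)%N \/ b = 0%N ->
  has_threshold r q d -> r%:R / (r + 1)%:R <= d.
Proof.
move=> r0 q0 Cr bq H [d0 [zeta [z0 [N _ HN]]]].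
rewrite leNgt; apply/negP => dlt.
(* The parameter [N.+1] makes the number of vertices positive and at least [N]. *)
have [V [e [f [cV se deg bal]]]] := exists_balanced N.+1 r0 q0 Cr bq H.
set L := (r * q * N.+1)%N in cV deg.
have L0 : (N < L)%N by rewrite /L mulnS; nia.
have [|||P [tP]] := HN #|V| _ _ V e f erefl se.
- by rewrite /= cV mulSn; apply: leq_trans (ltnW L0) (leq_addr _ _).
- by rewrite cV /L -mulnA mulnCA dvdn_mulr.
- apply: (@le_trans _ _ (r * L)%:R); last first.
    rewrite ler_nat; apply: leq_min_degree => [|v]; last by rewrite deg.
    by rewrite cV leq_mul2r leqnSn orbT.
  have r1 : 0 < (r + 1)%:R :> R by rewrite ltr0n addn1.
  have dr : d * (r + 1)%:R <= r%:R by rewrite -ler_pdivlMr // ltW.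
  by rewrite cV -[r.+1]addn1 natrM [(r * L)%:R]natrM mulrA ler_wpM2r.
have [pP _] := tilingP _ _ _ _ tP.
have := discrepancy_balanced R q0 pP (bal P tP) => le0 ge.
have : 0 < zeta * #|V|%:R by rewrite mulr_gt0 // ltr0n cV muln_gt0 /=; apply: leq_trans L0.
by rewrite ltNge (le_trans ge le0).
Qed.

Lemma threshold_upper (R : realType) (r q : nat) (eta : R) :
  (3 <= r)%N -> (2 <= q)%N -> 0 < eta -> has_threshold r q (r%:R / (r + 1)%:R + eta).
Proof.
move=> r3 q2 eta0.
have r0 : (0 < r)%N by apply: leq_trans r3.
have q0 : (0 < q)%N by apply: leq_trans q2.
have r1 : 0 < (r + 1)%:R :> R by rewrite ltr0n addn1.
split; first by rewrite ltr_wpDl // divr_ge0.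
(* An integer above 1 / eta, so that the surplus in the minimum degree is at least n / t. *)
pose t := (Num.trunc eta^-1).+1.
have tR : 0 < t%:R :> R by rewrite ltr0n.
have teta : 1 <= eta * t%:R.
  by rewrite -ler_pdivrMl // mulr1 ltW // truncnS_gt.
pose D := (8 * r * t)%N.
have D0 : (0 < D)%N by rewrite !muln_gt0 r0.
(* The discrepancy obtained is at least G / q, and G = n %/ D is at least n / (2 D). *)
exists (2 * D * q)%:R^-1; split.
  by rewrite invr_gt0 ltr0n muln_gt0 q0 andbT muln_gt0 D0.
(* The summand [D] makes [G] positive, on which the bound n <= 2 D G relies; the summand [t] gives
   the condition t < n of [size_bound]. *)
exists (D + t).+1 => //= n nN rn V e f cV [esym eirr] md.
pose M := (n - min_degree e)%N; pose G := (n %/ D)%N.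
have mdn : (t * (r + 1) * min_degree e >= t * r * n + (r + 1) * n)%N.
  rewrite -(ler_nat R) natrD !natrM.
  have rho : (r + 1)%:R * (r%:R / (r + 1)%:R) = r%:R :> R by rewrite mulrC divfK ?gt_eqF.
  apply: le_trans (ler_wpM2l (mulr_ge0 (ltW tR) (ltW r1)) md).
  set p := r%:R / _ in rho *.
  have -> : t%:R * (r + 1)%:R * ((p + eta) * n%:R) =
      t%:R * ((r + 1)%:R * p) * n%:R + (r + 1)%:R * n%:R * (eta * t%:R) by ring.
  by rewrite rho lerD2l ler_peMr // mulr_ge0 // ltW.
have GD : (G * D <= n)%N by apply: leq_divM.
have G0 : (0 < G)%N by rewrite divn_gt0 //; apply: leq_trans nN; rewrite leqW // leq_addr.
have nG : (n <= 2 * D * G)%N.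
  apply: leq_trans (ltnW (ltn_ceil n D0)) _.
  by rewrite mulSn -mulnA mul2n -addnn [(D * G)%N]mulnC leq_add2r leq_pmull.
have n0 : (0 < n)%N by apply: leq_trans nN.
have deg v : (#|[set w | e v w]%SET| + #|[set w | ~~ e v w]%SET| = n)%N.
  by rewrite -cV -(cardsC [set w | e v w]%SET); congr (_ + _)%N; apply: eq_card => w; rewrite !inE.
have nondeg v : (#|[set w | ~~ e v w]%SET| <= M)%N.
  by have := min_degree_leq e v; have := deg v; rewrite /M; clear; lia.
have dn : (min_degree e <= n)%N.
  have [v _] : exists v, v \in [set: V]%SET by apply/card_gt0P; rewrite cardsT cV.
  by have := min_degree_leq e v; have := deg v; clear; lia.
have sizeV : (r.+1 * M + (4 * r + 1) * G + r < #|V|)%N.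
  rewrite cV; apply: (@size_bound r t) => //.
  by apply: leq_ltn_trans nN; apply: leq_addl.
have rV : (r %| #|V|)%N by rewrite cV.
have [P [c [tP H]]] := exists_unbalanced_tiling f esym eirr r3 q2 nondeg rV sizeV.
have [pP _] := tilingP _ _ _ _ tP.
exists P; split=> //.
have qR : 0 < q%:R :> R by rewrite ltr0n.
have HE : (q * #|edges (tiling_graph P)| + G <= q ^ 2 * tiling_count f P c)%N.
  by rewrite (card_edges_tiling f pP) (tiling_total f r3 tP).
apply: le_trans (discrepancy_ge R q0 pP HE).
rewrite ler_pdivlMr // -mulrA ler_pdivrMl; last by rewrite ltr0n !muln_gt0 r0.
by rewrite -!natrM ler_nat mulnAC leq_mul2r nG orbT.
Qed.

Theorem theorem1p8 (R : realType) (r q a b : nat)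
    (hr : (3 <= r)%N) (hq : (2 <= q <= 'C(r, 2))%N)
    (hab : 'C(r, 2) = (a * q + b)%N) (hb : (b < q)%N)
    (h : (q <= r + b)%N \/ b = 0%N) :
  delta R r q = r%:R / (r + 1)%:R.
Proof.
have /andP[q2 _] := hq.
have lb : lbound [set d | has_threshold r q d] (r%:R / (r + 1)%:R : R).
  move=> d Hd; apply: threshold_lower hab hb h Hd; first exact: leq_trans hr.
  exact: leq_trans q2.
apply/eqP; rewrite eq_le; apply/andP; split.
  apply/ler_addgt0Pr => eta eta0.
  apply: ge_inf; last exact: threshold_upper.
  by exists (r%:R / (r + 1)%:R).
apply: lb_le_inf => //; exists (r%:R / (r + 1)%:R + 1).
exact: threshold_upper.
Qed.
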